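(* Let $d\ge1$, let $\mu$ be a non-trivial probability nc measure on $\mathscr{A}_d$ with associated orthonormal polynomials $(\varphi_\sigma)_{\sigma\in\mathbb{F}_d^+}$ and reverse polynomials $(\varphi_\sigma^{\#})_{\sigma\in\mathbb{F}_d^+}$, and let $n\in\mathbb{N}$. For $Z=(Z_1,\dots,Z_d)\in(\mathbb{C}^{m\times m})^d$ write $Z^*=(Z_1^*,\dots,Z_d^* )$. Then: (i) if $Z\in\mathbb{B}^d_{\mathrm{nc}}$, then $\varphi_{\sigma(n)}^{\#}(Z^* )^*\varphi_{\sigma(n)}^{\#}(Z^* )$ is non-singular, i.e. the set of all $Z\in\mathbb{C}^d_{\mathrm{nc}}$ with $\det\big(\varphi_{\sigma(n)}^{\#}(Z^* )^*\varphi_{\sigma(n)}^{\#}(Z^* )\big)=0$ does not meet $\mathbb{B}^d_{\mathrm{nc}}$; (ii) if $Z\in\mathrm{Ext}(\overline{\mathbb{B}}^d_{\mathrm{nc}})$, then $\sum_{|\sigma|=n}\varphi_\sigma(Z^* )^*\varphi_\sigma(Z^* )$ is non-singular, i.e. the set of all $Z\in\mathbb{C}^d_{\mathrm{nc}}$ with $\det\big(\sum_{|\sigma|=n}\varphi_\sigma(Z^* )^*\varphi_\sigma(Z^* )\big)=0$ does not meet $\mathrm{Ext}(\overline{\mathbb{B}}^d_{\mathrm{nc}})$; (iii) if $Z\in\partial\mathbb{B}^d_{\mathrm{nc}}$, then $\varphi_{\sigma(n)}^{\#}(Z^* )^*\varphi_{\sigma(n)}^{\#}(Z^* )$ and $\sum_{|\sigma|=n}\varphi_\sigma(Z^*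 )^*\varphi_\sigma(Z^* )$ are non-singular, and furthermore $$\varphi_{\sigma(n)}^{\#}(Z^* )^*\varphi_{\sigma(n)}^{\#}(Z^* )=\sum_{|\sigma|=n}\varphi_\sigma(Z^* )^*\varphi_\sigma(Z^* ).$$
   Context: Sets. $\mathbb{C}^d_{\mathrm{nc}}:=\bigsqcup_{m\ge1}(\mathbb{C}^{m\times m})^d$; the row-ball is $\mathbb{B}^d_{\mathrm{nc}}:=\{Z\in\mathbb{C}^d_{\mathrm{nc}}:Z_1Z_1^*+\cdots+Z_dZ_d^*<I\}$; $\mathrm{Ext}(\overline{\mathbb{B}}^d_{\mathrm{nc}}):=\{Z\in\mathbb{C}^d_{\mathrm{nc}}:Z_1Z_1^*+\cdots+Z_dZ_d^*>I\}$; $\partial\mathbb{B}^d_{\mathrm{nc}}:=\{Z\in\mathbb{C}^d_{\mathrm{nc}}:Z_1Z_1^*+\cdots+Z_dZ_d^*=I\}$ (here $I$ is the identity matrix of the appropriate size and $<$, $>$ mean that the difference is positive definite). Words. $\mathbb{F}_d^+$ is the free monoid on the generators $1,\dots,d$, with identity $\emptyset$ and product given by concatenation; $|\sigma|$ is the length of $\sigma$. Shortlex ordering: $\sigma\prec\tau$ if $|\sigma|<|\tau|$, or if $|\sigma|=|\tau|$ and $\sigma$ precedes $\tau$ lexicographically (with $1\prec\cdots\prec d$). $\sigma-1$ is the immediate predecessor of $\sigma\ne\emptyset$. $\sigma(n)=d\cdots d$ ($n$ copies) is the last word of length $n$; $\sigma(0)=\emptyset$. For a $d$-tuple $Z$ and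 $\sigma=\sigma_1\cdots\sigma_n$, $Z^\sigma:=Z_{\sigma_1}\cdots Z_{\sigma_n}$, $Z^\emptyset:=1$ (the identity). $\mathbb{C}\langle Z\rangle$ is the algebra of polynomials in noncommuting variables $Z_1,\dots,Z_d$ with complex coefficients. nc measures. The nc Hardy space $\mathbb{H}^2_d$ is the Hilbert space of formal power series $\sum_\sigma c_\sigma Z^\sigma$ with $\sum_\sigma|c_\sigma|^2<\infty$ and orthonormal basis $\{Z^\sigma\}$; $L=(L_1,\dots,L_d)$, $(L_jf)(Z)=Z_jf(Z)$, so $L_j^*L_k=\delta_{jk}I$. $\mathcal{A}_d$ is the operator-norm closure of $\{p(L):p\in\mathbb{C}\langle Z\rangle\}$ and $\mathscr{A}_d:=\overline{\mathcal{A}_d+\mathcal{A}_d^*}$ (operator-norm closure). An nc measure is a linear functional $\mu:\mathscr{A}_d\to\mathbb{C}$ with $\mu(f)\ge0$ for all positive operators $f\in\mathscr{A}_d$. For nc polynomials $P,Q$, $\mu(Q^*P)$ means $\mu(Q(L)^*P(L))$. Put $K_\mu(\sigma,\tau):=\mu((L^\tau)^*L^\sigma)$. $\mu$ is a probability nc measure if $\mu(I)=1$, and non-trivial if $[K_\mu(\sigma,\tau)]_{\sigma,\tau\preceq\sigma_0}$ is invertible for every $\sigma_0\in\mathbb{F}_d^+$. Orthogonal polynomials. For $\mu$ a non-trivial probability nc measure, $\langle P,Q\rangle_\mu:=\mu(Q^*P)$ is an inner product on $\mathbb{C}\langle Z\rangle$ with norm $\|\cdot\|_\mu$. The orthonormal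 polynomials $(\varphi_\sigma)$ are obtained by Gram–Schmidt (with normalisation, positive leading coefficients) applied to $\{Z^\sigma\}$ in shortlex order. The Verblunsky coefficients $(\gamma_\sigma)\subseteq\mathbb{D}$ (the open unit disc): $\gamma_\emptyset=0$ and for $\sigma\ne\emptyset$, $\gamma_\sigma$ is the Schur parameter $\gamma_{\emptyset,\sigma}$ (in the sense of Constantinescu) of $K_\mu$ viewed as a kernel on $\mathbb{N}$ via the shortlex order; explicitly $$\gamma_\sigma=\frac{\langle (I-P_\sigma)Z^\sigma,(I-P_\sigma)1\rangle_\mu}{\|(I-P_\sigma)Z^\sigma\|_\mu\,\|(I-P_\sigma)1\|_\mu},$$ where $P_\sigma$ is the $\langle\cdot,\cdot\rangle_\mu$-orthogonal projection onto $\mathrm{span}\{Z^\tau:\emptyset\prec\tau\prec\sigma\}$. The reverse polynomials $\varphi_\sigma^{\#}$ are the polynomials given by $\varphi_\emptyset^{\#}=1$ and the recurrences, for $\sigma\in\mathbb{F}_d^+$, $k\in\{1,\dots,d\}$, $$\varphi_{k\sigma}=\frac{1}{\sqrt{1-|\gamma_{k\sigma}|^2}}\big(Z_k\varphi_\sigma-\gamma_{k\sigma}\varphi_{k\sigma-1}^{\#}\big),\qquad \varphi^{\#}_{k\sigma}=\frac{1}{\sqrt{1-|\gamma_{k\sigma}|^2}}\big(-\overline{\gamma_{k\sigma}}Z_k\varphi_\sigma+\varphi^{\#}_{k\sigma-1}\big).$$ *)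

(* Defs.v *)
(* MathComp with MathComp-Analysis. The notations of [monalg] clash with those
   of MathComp-Analysis and are therefore not imported. *)
From HB Require Import structures.
From mathcomp Require Import all_boot all_order all_algebra.
From mathcomp Require Import finmap complex.
From mathcomp Require Import ring.
From mathcomp Require Import all_classical all_reals all_analysis.
From mathcomp Require Import -(notations) monalg.

Set Implicit Arguments.
Unset Strict Implicit.
Unset Printing Implicit Defensive.

Import Order.TTheory GRing.Theory Num.Theory numFieldNormedType.Exports.

Local Open Scope classical_set_scope.
Local Open Scope complex_scope.
Local Open Scope ring_scope.
Local Open Scope sesquilinear_scope.

(* There are d.+1 >= 1 variables, indexed by 'I_d.+1: generators are numbered
   from 0 and the last one is ord_max. *)
Notation word d := (seq 'I_d.+1).

Section Words.
Context (d : nat).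
Implicit Types (s t : word d) (n : nat).

Definition shortlex s t : bool :=
  (size s < size t)%N ||
  (size s == size t) && ((s : seqlexi 'I_d.+1) < (t : seqlexi 'I_d.+1))%O.

Fixpoint words n : seq (word d) :=
  if n is n'.+1 then [seq k :: s | k <- enum 'I_d.+1, s <- words n']
  else [:: [::]].

Definition preceding s : seq (word d) :=
  [seq t <- flatten [seq words n | n <- iota 0 (size s).+1] | shortlex t s].

Definition wpred s : word d := last [::] (preceding s).

Definition last_word n : word d := nseq n ord_max.

Lemma shortlex_trans : transitive shortlex.
Proof.
move=> y x z; rewrite /shortlex => /orP[h1|/andP[/eqP h1 h1']] /orP[h2|/andP[/eqP h2 h2']].
- by rewrite (ltn_trans h1 h2).
- by rewrite -h2 h1.
- by rewrite h1 h2.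
- by rewrite h1 h2 eqxx (lt_trans h1' h2') orbT.
Qed.

Lemma shortlex_irr : irreflexive shortlex.
Proof. by move=> x; rewrite /shortlex ltnn ltxx andbF. Qed.

Lemma mem_words n s : (s \in words n) = (size s == n).
Proof.
elim: n s => [|n IHn] s /=; first by rewrite inE size_eq0.
case: s => [|k s].
  by apply/negbTE/negP => /allpairsP[[? ?] /= [_ _]].
rewrite eqSS -IHn; apply/allpairsP/idP => [[[? ?] /= [_ h [_ ->]]] //|h].
by exists (k, s); rewrite mem_enum h.
Qed.

Lemma words_sorted n : sorted shortlex (words n).
Proof.
elim: n => //= n; set W := words n => IHn.
have sW : {in W, forall s, size s = n} by move=> s; rewrite mem_words => /eqP.
have allW : pairwise shortlex W by rewrite -sorted_pairwise //; exact: shortlex_trans.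
have en : pairwise (fun i j : 'I_d.+1 => i < j)%O (enum 'I_d.+1).
  rewrite -sorted_pairwise; last exact: lt_trans.
  by have := iota_ltn_sorted 0 d.+1; rewrite -val_enum_ord sorted_map.
apply: pairwise_sorted; elim: (enum _) en => //= k e IHe /andP[/allP hk /IHe pe].
rewrite pairwise_cat pe andbT; apply/andP; split.
  apply/allrelP => _ _ /mapP[s sin ->] /allpairsP[[j t] /= [je tin ->]].
  rewrite /shortlex /= (sW _ sin) (sW _ tin) ltnn eqxx /=.
  by rewrite ltxi_cons (ltW (hk _ je)) leNgt (hk _ je).
rewrite pairwise_map.
apply: (@sub_in_pairwise _ [in W] shortlex) allW => [s t sin tin|]; last exact/allP.
rewrite /shortlex /= (sW _ sin) (sW _ tin) ltnn eqxx /=.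
by rewrite ltxi_cons ltnn eqxx lexx.
Qed.

Lemma preceding_sorted s : sorted shortlex (preceding s).
Proof.
apply: sorted_filter; first exact: shortlex_trans.
rewrite sorted_pairwise; last exact: shortlex_trans.
elim: (size s).+1 0%N => //= n IHn m.
rewrite pairwise_cat IHn andbT -sorted_pairwise; last exact: shortlex_trans.
rewrite words_sorted andbT; apply/allrelP => u v; rewrite mem_words => /eqP hu.
case/flattenP => _ /mapP[k + ->]; rewrite mem_iota => /andP[hk _].
by rewrite mem_words => /eqP hv; rewrite /shortlex hu hv hk.
Qed.

Lemma mem_preceding s t : (t \in preceding s) = shortlex t s.
Proof.
rewrite mem_filter; case: (boolP (shortlex t s)) => //; rewrite andTb => h.
apply/flattenP; exists (words (size t)); last by rewrite mem_words.
apply/mapP; exists (size t) => //; rewrite mem_iota /= add0n ltnS.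
by case/orP: h => [/ltnW|/andP[/eqP->]].
Qed.

Lemma preceding_wpred s : s != [::] ->
  preceding s = rcons (preceding (wpred s)) (wpred s).
Proof.
move=> s0.
have : [::] \in preceding s.
  by rewrite mem_preceding /shortlex; case: (s) s0.
move: (preceding_sorted s) (mem_preceding s); rewrite /wpred.
case/lastP: (preceding s) => // p w; rewrite last_rcons => ps mp _.
congr rcons; apply: (irr_sorted_eq shortlex_trans shortlex_irr).
- move: ps; rewrite !sorted_pairwise; try exact: shortlex_trans.
  by rewrite pairwise_rcons => /andP[].
- exact: preceding_sorted.
move: ps; rewrite sorted_pairwise; last exact: shortlex_trans.
rewrite pairwise_rcons => /andP[/allP hp _] t; rewrite mem_preceding.
apply/idP/idP => [/hp //|tw].
have ws : shortlex w s by rewrite -mp mem_rcons inE eqxx.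
have := mp t; rewrite (shortlex_trans tw ws) mem_rcons inE => /orP[/eqP e|//].
by rewrite e shortlex_irr in tw.
Qed.

End Words.

Section HardySpace.
Context (R : realType) (d : nat).
Implicit Types (n : nat) (w : word d).

(* Sums over all words are limits of sums over the words of length < n. *)
Definition psum (F : word d -> R) n : R := \sum_(k < n) \sum_(w <- words d k) F w.

Definition wsum (F : word d -> R) : R := limn (psum F).

Definition csum (F : word d -> R[i]) : R[i] :=
  wsum (fun w => complex.Re (F w)) +i* wsum (fun w => complex.Im (F w)).

Definition normsq (z : R[i]) : R := complex.Re z ^+ 2 + complex.Im z ^+ 2.

Definition square_summable : {pred word d -> R[i]} :=
  fun f => `[< cvgn (psum (fun w => normsq (f w))) >].

Lemma psum_le (F G : word d -> R) n :
  (forall w, F w <= G w) -> psum F n <= psum G n.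
Proof. by move=> FG; apply: ler_sum => k _; apply: ler_sum. Qed.

Lemma normsq_ge0 z : 0 <= normsq z.
Proof. by rewrite addr_ge0 ?sqr_ge0. Qed.

Lemma square_summableP (f : word d -> R[i]) :
  reflect (exists M, forall n, psum (fun w => normsq (f w)) n <= M)
          (f \in square_summable).
Proof.
rewrite unfold_in /square_summable; apply: (iffP (asboolP _)) => [cf|[M fM]].
  have /pinfty_ex_gt0[M _ hM] := cvg_seq_bounded cf.
  by exists M => n; apply: le_trans (hM n I); exact: ler_norm.
apply: nondecreasing_is_cvgn; last by exists M => _ [n _ <-].
apply/nondecreasing_seqP => n; rewrite /psum big_ord_recr /= lerDl.
by apply: sumr_ge0 => t _; exact: normsq_ge0.
Qed.

Lemma square_summable_submod : submod_closed square_summable.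
Proof.
split=> [|a f g /square_summableP[M fM] /square_summableP[N gN]].
  apply/square_summableP; exists 0 => n.
  rewrite /psum big1 // => k _; rewrite big1 // => t _.
  by rewrite /normsq /= expr0n addr0.
apply/square_summableP; exists (2 * normsq a * M + 2 * N) => n.
pose G w := 2 * normsq a * normsq (f w) + 2 * normsq (g w).
apply: (le_trans (y := psum G n)).
  apply: psum_le => w; rewrite /G /normsq -subr_ge0.
  rewrite [(a *: f + g) w]/(a * f w + g w).
  case: (a) (f w) (g w) => [a1 a2] [f1 f2] [g1 g2] /=.
  set z := (X in 0 <= X).
  have -> : z = (a1 * f1 - a2 * f2 - g1) ^+ 2 + (a1 * f2 + a2 * f1 - g2) ^+ 2.
    by rewrite /z; ring.
  by rewrite addr_ge0 ?sqr_ge0.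
have -> : psum G n = 2 * normsq a * psum (fun w => normsq (f w)) n
                     + 2 * psum (fun w => normsq (g w)) n.
  rewrite /psum !mulr_sumr -big_split; apply: eq_bigr => k _ /=.
  by rewrite !mulr_sumr -big_split.
by rewrite lerD // ler_wpM2l // ?mulr_ge0 // normsq_ge0.
Qed.

HB.instance Definition _ :=
  GRing.isSubmodClosed.Build R[i] (word d -> R[i]) square_summable
    square_summable_submod.

(* The nc Hardy space: a power series is identified with its coefficients. *)
Record hardy := Hardy { coef :> word d -> R[i] ; _ : coef \in square_summable }.

HB.instance Definition _ := [isSub for coef].
HB.instance Definition _ := [Choice of hardy by <:].
HB.instance Definition _ := [SubChoice_isSubLmodule of hardy by <:].

Definition hdot (f g : hardy) : R[i] := csum (fun w => f w * (g w)^*).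

Definition hnorm (f : hardy) : R := Num.sqrt (complex.Re (hdot f f)).

(* Coefficients of the series Z_k f(Z). *)
Definition shift_coef (k : 'I_d.+1) (f : word d -> R[i]) : word d -> R[i] :=
  fun w => if w is j :: u then (if j == k then f u else 0) else 0.

Lemma shift_square_summable k (f : hardy) :
  shift_coef k f \in square_summable.
Proof.
have /square_summableP[M fM] : coef f \in square_summable by case: f.
apply/square_summableP; exists M => n.
have n0 : normsq 0 = 0 by rewrite /normsq /= expr0n addr0.
have M0 : 0 <= M by have := fM 0%N; rewrite /psum big_ord0.
case: n => [|n]; first by rewrite /psum big_ord0.
rewrite /psum big_ord_recl /= big_seq1 /= n0 add0r.
apply: le_trans (fM n); rewrite le_eqVlt; apply/orP; left; apply/eqP.
apply: eq_bigr => i _ /=; rewrite big_allpairs_dep big_enum /= (bigD1 k) //=.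
rewrite [X in _ + X]big1 ?addr0 => [|j jk].
  by apply: eq_bigr => w _; rewrite eqxx.
by apply: big1 => w _; rewrite (negbTE jk).
Qed.

Definition left_shift k (f : hardy) : hardy := Hardy (shift_square_summable k f).

End HardySpace.

Notation operator R d := (hardy R d -> hardy R d).

Section Operators.
Context (R : realType) (d : nat).
Implicit Types (S T : operator R d) (X : set (operator R d)).

Definition bounded_op T : Prop :=
  linear T /\ exists M : R, forall f, hnorm (T f) <= M * hnorm f.

(* Closure of X in the bounded operators: the last inequality is
   ||T - S|| <= e in operator norm. *)
Definition opclosure X : set (operator R d) :=
  [set T | bounded_op T /\ forall e : R, 0 < e ->
     exists2 S, X S & forall f, hnorm (T f - S f) <= e * hnorm f].

Definition is_adjoint T S : Prop := forall f g, hdot (T f) g = hdot f (S g).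

(* The value [id] is never used: bounded operators have adjoints. *)
Definition adjoint T : operator R d := xget (id : operator R d) [set S | is_adjoint T S].

Definition positive_op T : Prop := forall f, 0 <= hdot (T f) f.

Definition word_shift (w : word d) : operator R d :=
  foldr (fun k T => left_shift k \o T) id w.

End Operators.

(* The algebra of nc polynomials, as the algebra of the free monoid. *)
Notation ncpoly R d := (malg (fmonom 'I_d.+1) R[i]).

Section Polynomials.
Context (R : realType) (d : nat).

Definition ncmonom (w : word d) : ncpoly R d := mkmalgU (FMonom w) 1.

Definition ncvar (k : 'I_d.+1) : ncpoly R d := ncmonom [:: k].

Definition poly_op (P : ncpoly R d) : operator R d :=
  fun f => \sum_(w <- msupp P) mcoeff w P *: word_shift w f.

Definition ncspan (s : seq (word d)) : set (ncpoly R d) :=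
  [set P | exists c : word d -> R[i], P = \sum_(w <- s) c w *: ncmonom w].

Definition nceval m (Z : 'I_d.+1 -> 'M[R[i]]_m.+1) (P : ncpoly R d)
    : 'M[R[i]]_m.+1 :=
  mmap scalar_mx (fun w : fmonom 'I_d.+1 => \prod_(k <- w) Z k) P.

End Polynomials.

Section NCMeasure.
Context (R : realType) (d : nat).

Definition disc_algebra : set (operator R d) := opclosure (range (@poly_op R d)).

Definition disc_system : set (operator R d) :=
  opclosure [set T | exists A B,
    [/\ disc_algebra A, disc_algebra B & T = A + adjoint B]].

(* Only the values of [mu] on [disc_system] matter. *)
Definition nc_measure (mu : operator R d -> R[i]) : Prop :=
  (forall (a : R[i]) S T, disc_system S -> disc_system T ->
     mu (a *: S + T) = a * mu S + mu T) /\
  (forall T, disc_system T -> positive_op T -> 0 <= mu T).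

End NCMeasure.

Section OrthogonalPolynomials.
Context (R : realType) (d : nat) (mu : operator R d -> R[i]).

Definition probability_measure : Prop := mu id = 1.

Definition moment_kernel (s t : word d) : R[i] :=
  mu (adjoint (word_shift t) \o word_shift s).

Definition nontrivial : Prop := forall s0 : word d,
  let s := rcons (preceding s0) s0 in
  \matrix_(i < size s, j < size s)
    moment_kernel (nth [::] s i) (nth [::] s j) \in unitmx.

Definition mudot (P Q : ncpoly R d) : R[i] :=
  mu (adjoint (poly_op Q) \o poly_op P).

Definition munorm (P : ncpoly R d) : R[i] := sqrtC (mudot P P).

Definition gram_schmidt (s : seq (ncpoly R d)) : seq (ncpoly R d) :=
  foldl (fun acc P => let Q := P - \sum_(p <- acc) mudot P p *: p in
                      rcons acc ((munorm Q)^-1 *: Q)) [::] s.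

Definition orthopoly (w : word d) : ncpoly R d :=
  last 0 (gram_schmidt [seq ncmonom R t | t <- rcons (preceding w) w]).

(* Orthogonal projection onto the span of the monomials in [s]. *)
Definition muproj (s : seq (word d)) (P : ncpoly R d) : ncpoly R d :=
  xget 0 [set Q | ncspan s Q /\
                  forall w, w \in s -> mudot (P - Q) (ncmonom R w) = 0].

Definition verblunsky (w : word d) : R[i] :=
  if w is [::] then 0 else
  let s := [seq t <- preceding w | t != [::]] in
  let x := ncmonom R w - muproj s (ncmonom R w) in
  let y := 1 - muproj s 1 in
  mudot x y / (munorm x * munorm y).

(* [n] is the number of words preceding [w]. Only the recurrence giving
   phi^#_{k s} is part of the definition: the one giving phi_{k s} is a property
   of the Gram-Schmidt polynomials. *)
Fixpoint reverse_poly_rec (n : nat) (w : word d) : ncpoly R d :=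
  match n, w with
  | n'.+1, k :: s =>
      (sqrtC (1 - `|verblunsky w| ^+ 2))^-1 *:
        (- (verblunsky w)^* *: (ncvar R k * orthopoly s)
         + reverse_poly_rec n' (wpred w))
  | _, _ => 1
  end.

Definition reverse_poly (w : word d) : ncpoly R d :=
  reverse_poly_rec (size (preceding w)) w.

Lemma reverse_poly_nil : reverse_poly [::] = 1.
Proof. by rewrite /reverse_poly; case: (size _). Qed.

Lemma reverse_poly_cons k (s : word d) : let w := k :: s in
  reverse_poly w =
    (sqrtC (1 - `|verblunsky w| ^+ 2))^-1 *:
      (- (verblunsky w)^* *: (ncvar R k * orthopoly s)
       + reverse_poly (wpred w)).
Proof.
move=> w; rewrite {1}/reverse_poly (preceding_wpred (s := w)) //.
by rewrite size_rcons.
Qed.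

End OrthogonalPolynomials.

Section RowBall.
Context (R : realType) (d m : nat).
Implicit Types (Z : 'I_d.+1 -> 'M[R[i]]_m.+1).

Definition posdefmx (A : 'M[R[i]]_m.+1) : Prop :=
  A^t* = A /\ forall v : 'cV[R[i]]_m.+1, v != 0 -> 0 < (v^t* *m A *m v) 0 0.

Definition row_gram Z : 'M[R[i]]_m.+1 := \sum_k Z k *m (Z k)^t*.

Definition row_ball Z : Prop := posdefmx (1%:M - row_gram Z).

Definition row_ball_ext Z : Prop := posdefmx (row_gram Z - 1%:M).

Definition row_sphere Z : Prop := row_gram Z = 1%:M.

Definition adj_tuple Z : 'I_d.+1 -> 'M[R[i]]_m.+1 := fun k => (Z k)^t*.

End RowBall.

(* Main.v *)
Require Import Defs.
From mathcomp Require Import all_boot all_order all_algebra.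
From mathcomp Require Import finmap complex.
From mathcomp Require Import ring lra.
From mathcomp Require Import all_classical all_reals all_analysis.
From mathcomp Require Import -(notations) monalg.

(* Put [X = Z^*], evaluate everything at [X], and let [G = \sum_k X_k^* X_k],
   which is the row Gram matrix of [Z].  The recurrences write
   [(phi_{k s}, phi#_{k s})] as a matrix preserving [diag(1, -1)] applied to
   [(X_k phi_s, phi#_{k s - 1})], hence
     [phi#_{k s}^* phi#_{k s} - phi#_{k s - 1}^* phi#_{k s - 1}
        = phi_{k s}^* phi_{k s} - phi_s^* X_k^* X_k phi_s].
   Summing over the words up to [sigma(n)] in shortlex order gives
     [phi#_{sigma(n)}^* phi#_{sigma(n)}
        = \sum_{|s| = n} phi_s^* phi_s + \sum_{|s| < n} phi_s^* (1 - G) phi_s],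
   whose term [s = []] is [1 - G]: this yields (i), (ii) and the equality in (iii).
   For the non-singularity in (iii), a common null vector of [phi#_{sigma(n)}] and
   of the [phi_s], [|s| = n], is propagated to [n = 0] by inverting the recurrences.
   The recurrence for [phi] itself holds because [Z_k phi_s] and [phi#_{k s - 1}]
   are the normalized components of [Z^{k s}] and [1] orthogonal to the monomials
   strictly between; this uses only that [mu] makes left multiplication by the
   [Z_k] isometric with orthogonal ranges. *)

Import Order.TTheory GRing.Theory Num.Theory numFieldNormedType.Exports.
Local Open Scope classical_set_scope.
Local Open Scope complex_scope.
Local Open Scope ring_scope.
Local Open Scope sesquilinear_scope.
Set Implicit Arguments.
Unset Strict Implicit.
Unset Printing Implicit Defensive.

(** * The inner product of the Hardy space *)

Section HardySpace.
Context (R : realType) (d : nat).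
Implicit Types (F G : word d -> R) (f g h : hardy R d).

Lemma psum_linear (a b : R) F G :
  psum (fun w => a * F w + b * G w) = (fun n => a * psum F n + b * psum G n).
Proof.
apply/funext => n; rewrite /psum !mulr_sumr -big_split; apply: eq_bigr => k _.
by rewrite !mulr_sumr -big_split.
Qed.

Lemma cvgn_psum_linear (a b : R) F G : cvgn (psum F) -> cvgn (psum G) ->
  psum (fun w => a * F w + b * G w) @ \oo --> a * wsum F + b * wsum G.
Proof. by move=> cF cG; rewrite psum_linear; apply: cvgD; apply: cvgMr. Qed.

Lemma wsum_linear (a b : R) F G : cvgn (psum F) -> cvgn (psum G) ->
  wsum (fun w => a * F w + b * G w) = a * wsum F + b * wsum G.
Proof. by move=> cF cG; apply: cvg_lim => //; exact: cvgn_psum_linear. Qed.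

Lemma cvgn_psum_normsq f : cvgn (psum (fun w => normsq (f w))).
Proof. by case: f => f /= /asboolP. Qed.

Lemma cvgn_psum_Re f g : cvgn (psum (fun w => complex.Re (f w * (g w)^*))).
Proof.
have -> : (fun w => complex.Re (f w * (g w)^*)) =
    (fun w => 4^-1 * normsq ((f + g) w) + (- 4^-1) * normsq ((f - g) w)).
  apply/funext => w; rewrite /normsq.
  rewrite [(f + g) w]/(f w + g w) [(f - g) w]/(f w - g w).
  by case: (f w) (g w) => [a b] [a' b'] /=; field.
by apply/cvg_ex; eexists; apply: cvgn_psum_linear; exact: cvgn_psum_normsq.
Qed.

Lemma cvgn_psum_Im f g : cvgn (psum (fun w => complex.Im (f w * (g w)^*))).
Proof.
have -> : (fun w => complex.Im (f w * (g w)^*)) =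
    (fun w => complex.Re (((- 'i%C) *: f) w * (g w)^*)).
  apply/funext => w; rewrite [((- 'i%C) *: f) w]/(- 'i%C * f w).
  by case: (f w) (g w) => [a b] [a' b'] /=; ring.
exact: cvgn_psum_Re.
Qed.

Lemma hdot_linear (a : R[i]) f g h :
  hdot (a *: f + g) h = a * hdot f h + hdot g h.
Proof.
have [cRf cIf] := (@cvgn_psum_Re f h, @cvgn_psum_Im f h).
have [cRg cIg] := (@cvgn_psum_Re g h, @cvgn_psum_Im g h).
have E w : (a *: f + g) w * (h w)^* = a * (f w * (h w)^*) + g w * (h w)^*.
  by rewrite [(a *: f + g) w]/(a * f w + g w) mulrDl mulrA.
rewrite /hdot /csum; case: a E => x y E.
pose Fr w := complex.Re (f w * (h w)^*); pose Fi w := complex.Im (f w * (h w)^*).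
pose Gr w := complex.Re (g w * (h w)^*); pose Gi w := complex.Im (g w * (h w)^*).
(* The trivial coefficients 1 put both parts in the form of nested two-term combinations, to which
   [wsum_linear] applies twice. *)
have Er : (fun w => complex.Re (((x +i* y) *: f + g) w * (h w)^*)) =
    (fun w => 1 * (x * Fr w + (- y) * Fi w) + 1 * Gr w).
  by apply/funext => w; rewrite E /Fr /Fi /Gr; case: (f w * _) (g w * _) => ? ? [? ?] /=; ring.
have Ei : (fun w => complex.Im (((x +i* y) *: f + g) w * (h w)^*)) =
    (fun w => 1 * (x * Fi w + y * Fr w) + 1 * Gi w).
  by apply/funext => w; rewrite E /Fr /Fi /Gi; case: (f w * _) (g w * _) => ? ? [? ?] /=; ring.
rewrite Er Ei !wsum_linear //.
- apply/eqP; rewrite eq_complex /= -/Fr -/Fi -/Gr -/Gi.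
  by apply/andP; split; apply/eqP; ring.
- by apply/cvg_ex; eexists; exact: cvgn_psum_linear.
- by apply/cvg_ex; eexists; exact: cvgn_psum_linear.
Qed.

Lemma hdotC f g : hdot g f = (hdot f g)^*.
Proof.
rewrite /hdot /csum.
set F := fun w => complex.Re (f w * (g w)^*); set G := fun w => complex.Im (f w * (g w)^*).
have -> : (fun w => complex.Re (g w * (f w)^*)) = F.
  by apply/funext => w; rewrite /F; case: (f w) (g w) => [a b] [a' b'] /=; ring.
have -> : (fun w => complex.Im (g w * (f w)^*)) = (fun w => (-1) * G w + 0 * G w).
  by apply/funext => w; rewrite /G; case: (f w) (g w) => [a b] [a' b'] /=; ring.
rewrite wsum_linear; try exact: cvgn_psum_Im.
by rewrite mul0r addr0 mulN1r.
Qed.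

Lemma hdot_self f : hdot f f = (wsum (fun w => normsq (f w)))%:C.
Proof.
rewrite /hdot /csum; congr (wsum _ +i* _).
  by apply/funext => w; rewrite /normsq; case: (f w) => [a b] /=; ring.
have -> : (fun w => complex.Im (f w * (f w)^*)) = (fun w => 0).
  by apply/funext => w; case: (f w) => [a b] /=; ring.
have -> : @wsum R d (fun=> 0) = limn (fun=> 0 : R).
  by congr (limn _); apply/funext => n; rewrite /psum big1 // => k _; rewrite big1.
exact: lim_cst.
Qed.

Lemma hdot_ge0 f : 0 <= hdot f f.
Proof.
rewrite hdot_self ler0c; apply: limr_ge; first exact: cvgn_psum_normsq.
by apply: nearW => n; do 2 (apply: sumr_ge0 => ? _); exact: normsq_ge0.
Qed.

(** Partial sums of nonnegative terms stay below their limit, here 0, so every coefficient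
    vanishes. *)
Lemma hdot_eq0 f : hdot f f = 0 -> f = 0.
Proof.
rewrite hdot_self => -[w0]; apply/val_inj/funext => w.
have : psum (fun w => normsq (f w)) (size w).+1 <= 0.
  rewrite -w0; apply: nondecreasing_cvgn_le; last exact: cvgn_psum_normsq.
  apply/nondecreasing_seqP => n; rewrite /psum big_ord_recr /= lerDl.
  by apply: sumr_ge0 => t _; exact: normsq_ge0.
rewrite /psum big_ord_recr /= => le0.
have ge0 v : 0 <= normsq (f v) by exact: normsq_ge0.
have : normsq (f w) <= 0.
  apply: le_trans le0; rewrite (big_rem w) ?mem_words //=.
  rewrite addrCA lerDl addr_ge0 ?sumr_ge0 // => k _; exact: sumr_ge0.
rewrite /normsq => fw0.
have [p q] : 0 <= complex.Re (f w) ^+ 2 /\ 0 <= complex.Im (f w) ^+ 2.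
  by rewrite !sqr_ge0.
have [/eqP + /eqP] : complex.Re (f w) ^+ 2 = 0 /\ complex.Im (f w) ^+ 2 = 0 by lra.
rewrite !sqrf_eq0 => /eqP r0 /eqP i0.
by rewrite [RHS]/(0 : R[i]); case: (f w) r0 i0 => a b /= -> ->.
Qed.

Lemma hdot0l f : hdot 0 f = 0.
Proof.
have := hdot_linear 1 0 0 f; rewrite scale1r addr0 mul1r => /eqP.
by rewrite -[X in X == _]addr0 (inj_eq (addrI _)) => /eqP.
Qed.

Lemma hdotDl f g h : hdot (f + g) h = hdot f h + hdot g h.
Proof. by rewrite -[f]scale1r hdot_linear mul1r scale1r. Qed.

Lemma hdotZl (a : R[i]) f g : hdot (a *: f) g = a * hdot f g.
Proof. by rewrite -[a *: f]addr0 hdot_linear hdot0l addr0. Qed.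

Lemma hdotBl f g h : hdot (f - g) h = hdot f h - hdot g h.
Proof. by rewrite hdotDl -scaleN1r hdotZl mulN1r. Qed.

Lemma hdotDr f g h : hdot f (g + h) = hdot f g + hdot f h.
Proof. by rewrite hdotC hdotDl rmorphD /= -!hdotC. Qed.

Lemma hdotBr f g h : hdot f (g - h) = hdot f g - hdot f h.
Proof. by rewrite hdotC hdotBl rmorphB /= -!hdotC. Qed.

Lemma hdotZr (a : R[i]) f g : hdot f (a *: g) = a^* * hdot f g.
Proof. by rewrite hdotC hdotZl rmorphM /= -hdotC. Qed.

Lemma hdot_inj f g : (forall h, hdot h f = hdot h g) -> f = g.
Proof.
move=> fg; apply/eqP; rewrite -subr_eq0; apply/eqP/hdot_eq0.
by rewrite hdotBr fg subrr.
Qed.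

Lemma hnorm_ge0 f : 0 <= hnorm f.
Proof. exact: sqrtr_ge0. Qed.

Lemma hnorm_sqr f : hnorm f ^+ 2 = wsum (fun w => normsq (f w)).
Proof. by rewrite sqr_sqrtr hdot_self //; have := hdot_ge0 f; rewrite hdot_self ler0c. Qed.

Lemma hnorm_sqrE f : (hnorm f ^+ 2)%:C = hdot f f.
Proof. by rewrite hnorm_sqr hdot_self. Qed.

Lemma hnorm0 : hnorm (0 : hardy R d) = 0.
Proof. by rewrite /hnorm hdot0l sqrtr0. Qed.

Lemma hnormZ (a : R[i]) f : hnorm (a *: f) = Num.sqrt (normsq a) * hnorm f.
Proof.
apply: (pexpIrn (n := 2)); rewrite ?nnegrE ?mulr_ge0 ?hnorm_ge0 ?sqrtr_ge0 //.
apply/(@complexI R); rewrite hnorm_sqrE exprMn rmorphM /= hnorm_sqrE.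
rewrite sqr_sqrtr ?normsq_ge0 // hdotZl hdotZr mulrA; congr (_ * _).
by apply/eqP; case: a => x y; rewrite eq_complex /normsq /=; apply/andP; split; apply/eqP; ring.
Qed.

(* Replaces the triangle inequality, which would need Cauchy-Schwarz. *)
Lemma hnormD_sqr f g : hnorm (f + g) ^+ 2 <= 2 * (hnorm f ^+ 2 + hnorm g ^+ 2).
Proof.
have : hdot (f + g) (f + g) + hdot (f - g) (f - g) =
    (hdot f f + hdot g g) + (hdot f f + hdot g g).
  by rewrite !(hdotBl, hdotBr, hdotDl, hdotDr); ring.
rewrite !hdot_self -!hnorm_sqr => /(congr1 (@complex.Re R)) /=.
by have := sqr_ge0 (hnorm (f - g)); lra.
Qed.

End HardySpace.

(** * Noncommutative polynomials *)

Section MonoidAlgebra.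
Context (I : choiceType) (K : comNzRingType).
Local Notation A := (malg (fmonom I) K).
Local Notation monom s := (mkmalgU (FMonom s) 1 : A).
Implicit Types (P Q : A) (w : seq I).

Lemma malg_scale_monom (a : K) w : a *: monom w = mkmalgU (FMonom w) a.
Proof.
apply/malgP => u; rewrite (mcoeffZ a (monom w)) (mcoeffU (FMonom w) 1) (mcoeffU (FMonom w) a).
by case: (FMonom w == u); [exact: mulr1|exact: mulr0].
Qed.

Lemma malg_sum_monom P : P = \sum_(w <- msupp P) mcoeff w P *: monom w.
Proof.
rewrite {1}[P]monalgE; apply: eq_bigr => -[w] _.
by rewrite malg_scale_monom.
Qed.

Lemma malg_ind (S : A -> Prop) :
  S 0 -> (forall a w P, S P -> S (a *: monom w + P)) -> forall P, S P.
Proof.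
move=> S0 SD P; rewrite [P]malg_sum_monom.
by elim/big_rec: _ => // w Q _; exact: SD.
Qed.

Lemma malg_monomM u w : monom u * monom w = monom (u ++ w).
Proof.
rewrite malgM_def fgmulUU mulr1; congr mkmalgU.
by apply: val_inj; rewrite /= fmM.
Qed.

(* [malg] is declared an algebra only over commutative monoids. *)
Lemma malg_monom_scaleAr u (a : K) P : monom u * (a *: P) = a *: (monom u * P).
Proof.
have EM (b : K) w : monom u * (b *: monom w) = b *: monom (u ++ w).
  rewrite !malg_scale_monom malgM_def fgmulUU mul1r; congr mkmalgU.
  by apply: val_inj; rewrite /= fmM.
elim/malg_ind: P => [|b w P IHP]; first by rewrite !(scaler0, mulr0).
rewrite (scalerDr a) (mulrDr (monom u)) IHP [in RHS](mulrDr (monom u)).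
by rewrite (scalerDr a) (scalerA a b) (EM (a * b)) (EM b) (scalerA a b).
Qed.

Lemma malg_monom_scale_sub u (a : K) P Q :
  monom u * (a *: (P - Q)) = a *: (monom u * P - monom u * Q).
Proof. by rewrite malg_monom_scaleAr (mulrBr (monom u)). Qed.

Lemma malg_monom0 : monom [::] = 1.
Proof. by congr mkmalgU; apply: val_inj; rewrite /= fm1. Qed.

Lemma mcoeff_malg_monom w u : mcoeff (FMonom u) (monom w) = (w == u)%:R.
Proof. by rewrite mcoeffU1. Qed.

(** Cancellation can shrink the support of [a *: P + Q], so the three sums are compared over one
    common finite set, on which the additional coefficients are 0. *)
Lemma msupp_sum_malgD (V : lmodType K) (v : seq I -> V) (a : K) P Q :
  \sum_(w <- msupp (a *: P + Q)) mcoeff w (a *: P + Q) *: v w =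
  a *: (\sum_(w <- msupp P) mcoeff w P *: v w) + \sum_(w <- msupp Q) mcoeff w Q *: v w.
Proof.
pose D := (msupp (a *: P + Q) `|` msupp P `|` msupp Q)%fset.
have E (S : A) : (msupp S `<=` D)%fset ->
    \sum_(w <- msupp S) mcoeff w S *: v w = \sum_(w <- D) mcoeff w S *: v w.
  by move=> SD; apply: big_fset_incl => // w _ /mcoeff_outdom ->; rewrite scale0r.
rewrite !E; try by apply/fsubsetP => w wS; rewrite !inE wS ?orbT.
rewrite scaler_sumr -big_split; apply: eq_bigr => w _ /=.
by rewrite mcoeffD mcoeffZ scalerDl scalerA.
Qed.

Lemma msupp_sum_malg_monom (V : lmodType K) (v : seq I -> V) w :
  \sum_(u <- msupp (monom w)) mcoeff u (monom w) *: v u = v w.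
Proof. by rewrite msuppU oner_eq0 big_seq_fset1 mcoeffUU scale1r. Qed.

End MonoidAlgebra.

(** * The free algebra [ncpoly] *)

Section FreeAlgebra.
Context (R : realType) (d : nat).
Implicit Types (P Q : ncpoly R d) (w : word d).

Lemma ncpolyE P : P = \sum_(w <- msupp P) mcoeff w P *: ncmonom R w.
Proof. exact: malg_sum_monom. Qed.

Lemma ncpoly_ind (S : ncpoly R d -> Prop) :
  S 0 -> (forall a w P, S P -> S (a *: ncmonom R w + P)) -> forall P, S P.
Proof. exact: malg_ind. Qed.

Lemma ncvarM k w : ncvar R k * ncmonom R w = ncmonom R (k :: w).
Proof. exact: malg_monomM. Qed.

Lemma ncvar_scaleAr k (a : R[i]) P : ncvar R k * (a *: P) = a *: (ncvar R k * P).
Proof. exact: malg_monom_scaleAr. Qed.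

Lemma ncvar_scale_sub k (a : R[i]) P Q :
  ncvar R k * (a *: (P - Q)) = a *: (ncvar R k * P - ncvar R k * Q).
Proof. exact: malg_monom_scale_sub. Qed.

Lemma ncmonom0 : ncmonom R [::] = 1 :> ncpoly R d.
Proof. exact: malg_monom0. Qed.

Lemma mcoeff_monom w u : mcoeff (FMonom u) (ncmonom R w) = (w == u)%:R.
Proof. exact: mcoeff_malg_monom. Qed.

Lemma msupp_sum_linear (V : lmodType R[i]) (v : word d -> V) (a : R[i]) P Q :
  \sum_(w <- msupp (a *: P + Q)) mcoeff w (a *: P + Q) *: v w =
  a *: (\sum_(w <- msupp P) mcoeff w P *: v w) + \sum_(w <- msupp Q) mcoeff w Q *: v w.
Proof. exact: msupp_sum_malgD. Qed.

Lemma msupp_sum_monom (V : lmodType R[i]) (v : word d -> V) w :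
  \sum_(u <- msupp (ncmonom R w)) mcoeff u (ncmonom R w) *: v u = v w.
Proof. exact: msupp_sum_malg_monom. Qed.

End FreeAlgebra.

(** * Adjoints and the disc system *)

Section Adjoints.
Context (R : realType) (d : nat).
Implicit Types (f g h : hardy R d) (S T : operator R d).

Lemma is_adjoint_sym S T : is_adjoint T S -> is_adjoint S T.
Proof. by move=> TS f g; rewrite hdotC -TS -hdotC. Qed.

Lemma is_adjoint_unique T S S' : is_adjoint T S -> is_adjoint T S' -> S = S'.
Proof.
by move=> TS TS'; apply/funext => g; apply: hdot_inj => f; rewrite -TS TS'.
Qed.

(** [adjoint] is a choice made by [xget]; adjoints being unique, exhibiting one computes it. *)
Lemma adjointE T S : is_adjoint T S -> adjoint T = S.
Proof.
move=> TS; apply: xget_unique => // S' TS'; exact: is_adjoint_unique TS' TS.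
Qed.

Lemma is_adjoint_id : is_adjoint (id : operator R d) id.
Proof. by []. Qed.

Lemma is_adjoint0 : is_adjoint (0 : operator R d) 0.
Proof. by move=> f g; rewrite hdot0l (hdotC 0) hdot0l conjC0. Qed.

Lemma is_adjoint_comp T S T' S' :
  is_adjoint T S -> is_adjoint T' S' -> is_adjoint (T \o T') (S' \o S).
Proof. by move=> TS TS' f g; rewrite /= TS TS'. Qed.

Lemma is_adjoint_linear (a : R[i]) T S T' S' :
  is_adjoint T S -> is_adjoint T' S' -> is_adjoint (a *: T + T') (a^* *: S + S').
Proof.
move=> TS TS' f g; rewrite hdot_linear TS TS' [in RHS]hdotC.
by rewrite hdot_linear rmorphD rmorphM /= conjCK -!hdotC.
Qed.

Lemma is_adjoint_lin T S : is_adjoint T S -> linear T.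
Proof.
move=> TS a f g; apply: hdot_inj => h.
by rewrite hdotC TS hdot_linear -!TS -hdot_linear -hdotC.
Qed.

Lemma is_adjoint_op0 T S : is_adjoint T S -> T 0 = 0.
Proof.
move=> /is_adjoint_lin/(_ (-1) 0 0).
by rewrite scaler0 addr0 scaleN1r addNr.
Qed.

(** Unlike in [bounded_op], the bound is nonnegative, so that bounds multiply under composition. *)
Definition op_bounded T := exists2 M : R, 0 <= M & forall f, hnorm (T f) <= M * hnorm f.

Lemma op_bounded_linear (a : R[i]) T S :
  op_bounded T -> op_bounded S -> op_bounded (a *: T + S).
Proof.
move=> [M M0 TM] [N N0 SN]; pose r := Num.sqrt (normsq a) * M.
have r0 : 0 <= r by rewrite mulr_ge0 ?sqrtr_ge0.
(* The factor 2 absorbs the loss in [hnormD_sqr]: [2 (X^2 + Y^2) <= (2 (X + Y))^2] for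
   [X, Y >= 0]. *)
exists (2 * (r + N)); first by rewrite mulr_ge0 ?addr_ge0.
move=> f; rewrite -ler_sqr ?nnegrE ?hnorm_ge0 ?mulr_ge0 ?addr_ge0 ?hnorm_ge0 //.
apply: le_trans (hnormD_sqr _ _) _; rewrite hnormZ.
have h1 : Num.sqrt (normsq a) * hnorm (T f) <= r * hnorm f.
  by rewrite -mulrA ler_wpM2l ?sqrtr_ge0.
have k1 : 0 <= Num.sqrt (normsq a) * hnorm (T f) by rewrite mulr_ge0 ?sqrtr_ge0 ?hnorm_ge0.
have k2 := hnorm_ge0 (S f); have h2 := SN f.
have k3 := hnorm_ge0 f.
move: (Num.sqrt _ * _) (hnorm (S f)) h1 k1 k2 h2 => x y h1 k1 k2 h2.
have x2 : x ^+ 2 <= (r * hnorm f) ^+ 2 by rewrite ler_sqr ?nnegrE // mulr_ge0.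
have y2 : y ^+ 2 <= (N * hnorm f) ^+ 2 by rewrite ler_sqr ?nnegrE // mulr_ge0.
have XY : 0 <= (r * hnorm f) * (N * hnorm f) by rewrite !mulr_ge0.
rewrite -mulrA [(r + N) * _]mulrDl; move: (r * _) (N * _) x2 y2 XY => X Y x2 y2 XY.
have -> : (2 * (X + Y)) ^+ 2 = 4 * (X ^+ 2 + Y ^+ 2) + 8 * (X * Y) by ring.
have := sqr_ge0 X; have := sqr_ge0 Y; lra.
Qed.

Lemma op_bounded0 : op_bounded 0.
Proof. by exists 0 => // f; rewrite mul0r hnorm0. Qed.

Lemma op_bounded_comp T S : op_bounded T -> op_bounded S -> op_bounded (T \o S).
Proof.
move=> [M M0 TM] [N N0 SN]; exists (M * N); rewrite ?mulr_ge0 // => f /=.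
by apply: le_trans (TM _) _; rewrite -mulrA ler_wpM2l.
Qed.

(** Boundedness is carried along on both sides because [opclosure] contains bounded operators only,
    and adjoints must belong to it too. *)
Definition adjoint_pair T S := [/\ is_adjoint T S, op_bounded T & op_bounded S].

Lemma adjoint_pair_id : adjoint_pair id id.
Proof. by split=> //; exists 1 => // f; rewrite mul1r. Qed.

Lemma adjoint_pair0 : adjoint_pair 0 0.
Proof. by split; [exact: is_adjoint0|exact: op_bounded0|exact: op_bounded0]. Qed.

Lemma adjoint_pair_linear (a : R[i]) T S T' S' : adjoint_pair T S ->
  adjoint_pair T' S' -> adjoint_pair (a *: T + T') (a^* *: S + S').
Proof.
move=> [TS bT bS] [TS' bT' bS'].
by split; [exact: is_adjoint_linear|exact: op_bounded_linear|exact: op_bounded_linear].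
Qed.

Lemma adjoint_pair_comp T S T' S' :
  adjoint_pair T S -> adjoint_pair T' S' -> adjoint_pair (T \o T') (S' \o S).
Proof.
move=> [TS bT bS] [TS' bT' bS'].
by split; [exact: is_adjoint_comp|exact: op_bounded_comp|exact: op_bounded_comp].
Qed.

(** * Shifts and their adjoints *)

Lemma psum_recl (F : word d -> R) n :
  psum F n.+1 = F [::] + \sum_k psum (fun w => F (k :: w)) n.
Proof.
rewrite /psum big_ord_recl /= big_seq1; congr (_ + _).
rewrite exchange_big; apply: eq_bigr => i _ /=.
by rewrite big_allpairs_dep big_enum.
Qed.

Lemma back_shift_subproof k f : (fun w => f (k :: w)) \in @square_summable R d.
Proof.
have /square_summableP[M fM] : coef f \in @square_summable R d by case: f.
apply/square_summableP; exists M => n; apply: le_trans (fM n.+1).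
rewrite psum_recl (bigD1 k) //= addrCA lerDl addr_ge0 ?normsq_ge0 //.
by do 3 (apply: sumr_ge0 => ? _); exact: normsq_ge0.
Qed.

Definition back_shift k f : hardy R d := Hardy (back_shift_subproof k f).

(** [left_shift] lengthens words by one letter, so partial sums match with an offset of one, which
    the limit does not see. *)
Lemma wsum_shift (F G : word d -> R) :
  cvgn (psum G) -> (forall n, psum F n.+1 = psum G n) -> wsum F = wsum G.
Proof.
move=> cG FG; apply: cvg_lim => //; rewrite -cvg_shiftS.
by under eq_fun do rewrite FG.
Qed.

Lemma left_shift_adjoint k : is_adjoint (@left_shift R d k) (back_shift k).
Proof.
move=> f g; rewrite /hdot /csum.
have E (p : R[i] -> R) n : p 0 = 0 ->
    psum (fun w => p (left_shift k f w * (g w)^*)) n.+1 =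
    psum (fun w => p (f w * (back_shift k g w)^*)) n.
  move=> p0; rewrite psum_recl /= mul0r p0 add0r (bigD1 k) //=.
  rewrite [X in _ + X]big1 => [|j /negbTE jk]; last first.
    by rewrite /psum big1 // => i _; rewrite big1 // => w _; rewrite jk mul0r.
  by rewrite addr0 eqxx.
congr (_ +i* _); apply: wsum_shift => [|n].
- exact: (@cvgn_psum_Re R d f (back_shift k g)).
- exact: (E (@complex.Re R)).
- exact: (@cvgn_psum_Im R d f (back_shift k g)).
- exact: (E (@complex.Im R)).
Qed.

(** The relations [L_j^* L_k = delta_jk I] of the left shifts. *)
Lemma back_shiftK j k : back_shift j \o left_shift k = (j == k)%:R *: (id : operator R d).
Proof.
apply/funext => f; apply/val_inj/funext => w.
transitivity ((j == k)%:R * f w); last by [].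
transitivity (if j == k then f w else 0); first by [].
by case: (j == k); rewrite ?mul1r ?mul0r.
Qed.

Lemma back_left_shift k f : back_shift k (left_shift k f) = f.
Proof. by rewrite -[LHS]/((back_shift k \o left_shift k) f) back_shiftK eqxx scale1r. Qed.

Lemma left_shift_pair k : adjoint_pair (@left_shift R d k) (back_shift k).
Proof.
have adj := @left_shift_adjoint k; split=> //; exists 1 => // f; rewrite mul1r.
  rewrite -ler_sqr ?nnegrE ?hnorm_ge0 // -lecR !hnorm_sqrE adj.
  by rewrite back_left_shift.
rewrite -ler_sqr ?nnegrE ?hnorm_ge0 // -lecR !hnorm_sqrE -subr_ge0.
(* The squared norm of [f - L_k L_k^* f] equals [|f|^2 - |L_k^* f|^2], so [L_k^*] is a
   contraction. *)
have := hdot_ge0 (f - left_shift k (back_shift k f)).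
rewrite !(hdotBl, hdotBr) [hdot (left_shift _ _) f]adj adj back_left_shift.
by rewrite subrr subr0 (is_adjoint_sym adj).
Qed.

Definition adjointable T := adjoint_pair T (adjoint T).

Lemma adjoint_pairE T S : adjoint_pair T S -> adjointable T.
Proof. by move=> TS; rewrite /adjointable (@adjointE _ S) //; case: TS. Qed.

Lemma word_shift_adjointable w : adjointable (@word_shift R d w).
Proof.
elim: w => [|k w IHw]; first exact: (adjoint_pairE adjoint_pair_id).
exact/adjoint_pairE/(adjoint_pair_comp (left_shift_pair k) IHw).
Qed.

(** * The operators [P(L)] and their adjoints *)

Lemma poly_op_linear (a : R[i]) (P Q : ncpoly R d) :
  poly_op (a *: P + Q) = a *: poly_op P + poly_op Q.
Proof.
by apply/funext => f; exact: (msupp_sum_linear (fun w => word_shift w f)).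
Qed.

Lemma poly_op_monom w : poly_op (ncmonom R w) = @word_shift R d w.
Proof.
by apply/funext => f; exact: (msupp_sum_monom (fun w => word_shift w f)).
Qed.

Lemma poly_op0 : poly_op 0 = 0 :> operator R d.
Proof. by apply/funext => f; rewrite /poly_op msupp0 big_seq_fset0. Qed.

Lemma poly_op_adjointable (P : ncpoly R d) : adjointable (poly_op P).
Proof.
elim/ncpoly_ind: P => [|a w P IHP].
  by rewrite poly_op0; exact: (adjoint_pairE adjoint_pair0).
rewrite poly_op_linear poly_op_monom.
exact/adjoint_pairE/(adjoint_pair_linear a (word_shift_adjointable w) IHP).
Qed.

Lemma adjoint_poly_op (a : R[i]) (P Q : ncpoly R d) :
  adjoint (poly_op (a *: P + Q)) = a^* *: adjoint (poly_op P) + adjoint (poly_op Q).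
Proof.
rewrite poly_op_linear; apply: adjointE.
by have [adjP _ _] := poly_op_adjointable P; have [adjQ _ _] := poly_op_adjointable Q;
  exact: is_adjoint_linear.
Qed.

Lemma adjoint_poly_op0 : adjoint (poly_op 0) = 0 :> operator R d.
Proof. by rewrite poly_op0; exact: adjointE is_adjoint0. Qed.

Lemma poly_op_ncvar k (P : ncpoly R d) :
  poly_op (ncvar R k * P) = left_shift k \o poly_op P.
Proof.
have linL := is_adjoint_lin (left_shift_adjoint k).
elim/ncpoly_ind: P => [|a w P IHP].
  rewrite mulr0 poly_op0; apply/funext => f /=.
  by rewrite (is_adjoint_op0 (left_shift_adjoint k)).
rewrite mulrDr ncvar_scaleAr ncvarM !poly_op_linear IHP !poly_op_monom.
by apply/funext => f; apply/esym/linL.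
Qed.

Lemma adjoint_poly_op_ncvar k (P : ncpoly R d) :
  adjoint (poly_op (ncvar R k * P)) = adjoint (poly_op P) \o back_shift k.
Proof.
rewrite poly_op_ncvar; apply: adjointE; apply: is_adjoint_comp.
  exact: left_shift_adjoint.
by case: (poly_op_adjointable P).
Qed.

(** * The products [Q(L)^* P(L)] lie in the disc system *)

Lemma adjointable_bounded T : adjointable T -> bounded_op T /\ bounded_op (adjoint T).
Proof.
move=> [adj [M _ TM] [N _ SN]]; split; split.
- exact: is_adjoint_lin adj.
- by exists M.
- exact: is_adjoint_lin (is_adjoint_sym adj).
- by exists N.
Qed.

Lemma bounded_opclosure (X : set (operator R d)) T :
  bounded_op T -> X T -> opclosure X T.
Proof.
move=> bT XT; split=> // e e0; exists T => // f.
by rewrite subrr hnorm0 mulr_ge0 ?hnorm_ge0 // ltW.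
Qed.

(** A purely algebraic part of the disc system, in which membership is checked without limits. *)
Definition poly_system : set (operator R d) :=
  [set T | exists P Q, T = poly_op P + adjoint (poly_op Q)].

Lemma poly_system_sub T : poly_system T -> disc_system T.
Proof.
have algP (P : ncpoly R d) : disc_algebra (poly_op P).
  by apply: bounded_opclosure; [case: (adjointable_bounded (poly_op_adjointable P))|exists P].
move=> [P [Q ->]]; apply: bounded_opclosure; last first.
  by exists (poly_op P), (poly_op Q); split.
have [adjP bP _] := poly_op_adjointable P.
have [adjQ _ bQ] := poly_op_adjointable Q.
have linP := is_adjoint_lin adjP; have linQ := is_adjoint_lin (is_adjoint_sym adjQ).
split.
  move=> a f g.
  rewrite -[LHS]/(poly_op P (a *: f + g) + adjoint (poly_op Q) (a *: f + g)).
  by rewrite linP linQ addrACA -scalerDr.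
have := op_bounded_linear 1 bP bQ; rewrite scale1r => -[M _ PQM].
by exists M.
Qed.

Lemma poly_system0 : poly_system 0.
Proof. by exists 0, 0; rewrite poly_op0 (adjointE is_adjoint0) addr0. Qed.

Lemma poly_system_linear (a : R[i]) T S :
  poly_system T -> poly_system S -> poly_system (a *: T + S).
Proof.
move=> [P [Q ->]] [P' [Q' ->]]; exists (a *: P + P'), (a^* *: Q + Q').
rewrite poly_op_linear adjoint_poly_op conjCK scalerDr; exact: addrACA.
Qed.

(** Equal leading letters of [v] and [w] cancel by [L_j^* L_k = delta_jk I], different ones give 0;
    once a word is exhausted, a word shift or the adjoint of one remains. *)
Lemma poly_system_monom v w :
  poly_system (adjoint (@word_shift R d v) \o word_shift w).
Proof.
elim: v w => [|j v IHv] w.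
  rewrite (adjointE is_adjoint_id).
  by exists (ncmonom R w), 0; rewrite adjoint_poly_op0 addr0 poly_op_monom.
case: w => [|k w].
  by exists 0, (ncmonom R (j :: v)); rewrite poly_op0 add0r poly_op_monom.
rewrite -!poly_op_monom -!ncvarM adjoint_poly_op_ncvar poly_op_ncvar.
rewrite (_ : _ \o _ = (j == k)%:R *: (adjoint (word_shift v) \o word_shift w) + 0).
  exact: poly_system_linear (IHv w) poly_system0.
rewrite !poly_op_monom addr0; apply/funext => f.
rewrite -[LHS]/(adjoint (word_shift v) ((back_shift j \o left_shift k) (word_shift w f))).
rewrite back_shiftK.
have [/is_adjoint_sym adjv _ _] := word_shift_adjointable v.
by have := is_adjoint_lin adjv (j == k)%:R (word_shift w f) 0;
  rewrite (is_adjoint_op0 adjv) !addr0.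
Qed.

(** Sesquilinear extension from words. Consequently [mudot] evaluates [mu] only on the disc system,
    where it is linear and positive. *)
Lemma poly_system_poly (P Q : ncpoly R d) :
  poly_system (adjoint (poly_op Q) \o poly_op P).
Proof.
elim/ncpoly_ind: Q => [|b v Q IHQ].
  by rewrite adjoint_poly_op0; exact: poly_system0.
rewrite adjoint_poly_op.
suff mP : poly_system (adjoint (poly_op (ncmonom R v)) \o poly_op P).
  exact: (poly_system_linear b^* mP IHQ).
have [/is_adjoint_sym] := word_shift_adjointable v; rewrite poly_op_monom => adjv _ _.
elim/ncpoly_ind: P {IHQ} => [|a w P IHP].
  rewrite (_ : _ \o _ = 0); first exact: poly_system0.
  by apply/funext => f; rewrite poly_op0 /= (is_adjoint_op0 adjv).
rewrite (_ : _ \o _ = a *: (adjoint (word_shift v) \o word_shift w) +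
    (adjoint (word_shift v) \o poly_op P)).
  exact: poly_system_linear (poly_system_monom _ _) IHP.
apply/funext => f; rewrite poly_op_linear poly_op_monom.
exact: (is_adjoint_lin adjv).
Qed.

End Adjoints.

Lemma subZ_swap (K : nzRingType) (V : lmodType K) (b : K) (x y : V) :
  y - b *: x = - b *: x + y.
Proof. by rewrite scaleNr addrC. Qed.

(** * Gram-Schmidt residuals in an inner product space *)

Section InnerProduct.
Context (C : numClosedFieldType) (V : lmodType C) (dot : V -> V -> C).
Implicit Types (x y z : V) (a b : C).

Definition inner_product :=
  [/\ forall a x y z, dot (a *: x + y) z = a * dot x z + dot y z,
      forall x y, dot y x = (dot x y)^*
    & forall x, x != 0 -> 0 < dot x x].

(* Polarization: x + y and x + i y have real norm. *)
Lemma sesquilinear_real_hermitian :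
    (forall a x y z, dot (a *: x + y) z = a * dot x z + dot y z) ->
    (forall a x y z, dot z (a *: x + y) = a^* * dot z x + dot z y) ->
    (forall x, (dot x x)^* = dot x x) ->
  forall x y, dot y x = (dot x y)^*.
Proof.
move=> linl linr real x y.
have h1 := real (1 *: x + y); have h2 := real ('i *: x + y).
rewrite !(linl, linr) !(rmorphD, rmorphM) /= !real !conjC1 !mul1r in h1.
rewrite !(linl, linr) !(rmorphD, rmorphM) /= !real !conjCK !conjCi in h2.
move: (dot x x) (dot y y) (dot x y) (dot y x) h1 h2 => p q b c h1 h2.
have {}h1 : b^* + c^* = b + c.
  have /eqP := h1; rewrite -subr_eq0 => /eqP h.
  by apply/eqP; rewrite -subr_eq0 -h; apply/eqP; ring.
have {}h2 : 'i * (c^* - b^*) = 'i * (b - c).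
  have /eqP := h2; rewrite -subr_eq0 => /eqP h.
  by apply/eqP; rewrite -subr_eq0 -h; apply/eqP; ring.
have {}h2 : c^* - b^* = b - c by apply: (mulfI _ h2); exact: neq0Ci.
have /mulfI : (2 : C) != 0 by rewrite pnatr_eq0.
apply; have -> : 2 * c = (b + c) - (b - c) by ring.
by rewrite -h1 -h2; ring.
Qed.

Lemma sesquilinear_null :
    (forall a x y z, dot (a *: x + y) z = a * dot x z + dot y z) ->
    (forall x y, dot y x = (dot x y)^*) -> (forall x, 0 <= dot x x) ->
  forall x, dot x x = 0 -> forall y, dot x y = 0.
Proof.
move=> linl herm ge0 x x0 y; apply/eqP/negPn/negP => g0.
have linr a u v w : dot w (a *: u + v) = a^* * dot w u + dot w v.
  by rewrite herm linl rmorphD rmorphM /= -!herm.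
set g := dot x y in g0; set q := dot y y.
have q0 : 0 <= q by exact: ge0.
(* With this [t], the vector [y - t g^* x] would have squared norm
   [q - 2 t |g|^2 = - (q + 2) < 0]. *)
pose t := (q + 1) / `|g| ^+ 2.
have n0 : `|g| ^+ 2 != 0 by rewrite expf_eq0 normr_eq0.
have t0 : 0 <= t by rewrite divr_ge0 ?addr_ge0 ?ler01 ?exprn_ge0.
have := ge0 (- (t * g^*) *: x + y).
rewrite !(linl, linr) x0 (herm x y) -/g -/q rmorphN rmorphM /= conjCK.
rewrite (CrealP (ger0_real t0)).
have -> : - (t * g^*) * (- (t * g) * 0 + g) + (- (t * g) * g^* + q) =
    - (q + 2).
  have tg : t * (g * g^*) = q + 1 by rewrite -normCK divfK.
  by transitivity (q - 2 * (t * (g * g^*))); [ring|rewrite tg; ring].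
by rewrite oppr_ge0 lt_geF // ltr_wpDl // ltr0n.
Qed.

Section Theory.
Context (ip : inner_product).

Lemma dot_linear a x y z : dot (a *: x + y) z = a * dot x z + dot y z.
Proof. by case: ip. Qed.

Lemma dotC x y : dot y x = (dot x y)^*.
Proof. by case: ip. Qed.

Lemma dot_gt0 x : x != 0 -> 0 < dot x x.
Proof. by case: ip => _ _; exact. Qed.

Lemma dot0l x : dot 0 x = 0.
Proof.
have := dot_linear 1 0 0 x; rewrite scale1r addr0 mul1r => /eqP.
by rewrite -[X in X == _]addr0 (inj_eq (addrI _)) => /eqP.
Qed.

Lemma dotDl x y z : dot (x + y) z = dot x z + dot y z.
Proof. by rewrite -[x]scale1r dot_linear mul1r scale1r. Qed.

Lemma dotZl a x z : dot (a *: x) z = a * dot x z.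
Proof. by rewrite -[a *: x]addr0 dot_linear dot0l addr0. Qed.

Lemma dotBl x y z : dot (x - y) z = dot x z - dot y z.
Proof. by rewrite dotDl -scaleN1r dotZl mulN1r. Qed.

Lemma dotZr a x z : dot x (a *: z) = a^* * dot x z.
Proof. by rewrite dotC dotZl rmorphM /= -dotC. Qed.

Lemma dotDr x y z : dot x (y + z) = dot x y + dot x z.
Proof. by rewrite dotC dotDl rmorphD /= -!dotC. Qed.

Lemma dotBr x y z : dot x (y - z) = dot x y - dot x z.
Proof. by rewrite dotC dotBl rmorphB /= -!dotC. Qed.

Lemma dot_suml (r : seq V) (F : V -> V) z :
  dot (\sum_(p <- r) F p) z = \sum_(p <- r) dot (F p) z.
Proof. by elim/big_rec2: _ => [|p u v _ <-]; rewrite ?dot0l ?dotDl. Qed.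

Lemma dot_sym0 x y : dot x y = 0 -> dot y x = 0.
Proof. by move=> xy0; rewrite dotC xy0 conjC0. Qed.

Lemma dot_eq0 x : dot x x = 0 -> x = 0.
Proof. by move=> x0; apply/eqP; apply: contraPT x0 => /dot_gt0/gt_eqF/eqP. Qed.

Definition dnorm x := sqrtC (dot x x).

Lemma dnorm_gt0 x : x != 0 -> 0 < dnorm x.
Proof. by move=> /dot_gt0 x0; rewrite sqrtC_gt0. Qed.

Lemma dnormalize x : x != 0 -> dot ((dnorm x)^-1 *: x) ((dnorm x)^-1 *: x) = 1.
Proof.
move=> x0; have n0 := dnorm_gt0 x0.
have xE : dot x x = dnorm x * dnorm x by rewrite -expr2 sqrtCK.
rewrite dotZl dotZr (CrealP _) ?rpredV ?gtr0_real // xE.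
by rewrite mulKf ?mulVf // gt_eqF.
Qed.

(** * Spans and residuals of a family of vectors *)

Section Family.
Context (T : eqType) (e : T -> V).
Implicit Types (D : {pred T}) (t : T).

(** Inductive, so that properties of a span are proved term by term, and over a predicate, so that
    no enumeration of [D] is involved. *)
Inductive spanned D : V -> Prop :=
| spanned0 : spanned D 0
| spannedD a t x : t \in D -> spanned D x -> spanned D (a *: e t + x).

Lemma spanned_linear D a x y : spanned D x -> spanned D y -> spanned D (a *: x + y).
Proof.
move=> xD yD; elim: xD => [|b t z tD _ IHz]; first by rewrite scaler0 add0r.
by rewrite scalerDr scalerA -addrA; exact: spannedD.
Qed.

Lemma spanned_gen D t : t \in D -> spanned D (e t).
Proof.
by move=> tD; rewrite -[e t]scale1r -[_ *: _]addr0; apply: spannedD => //; exact: spanned0.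
Qed.

Lemma spannedB D x y : spanned D x -> spanned D y -> spanned D (x - y).
Proof. by move=> xD yD; rewrite addrC -scaleN1r; exact: spanned_linear. Qed.

Lemma spanned_sum D (r : seq V) (c : V -> C) :
  (forall p, p \in r -> spanned D p) -> spanned D (\sum_(p <- r) c p *: p).
Proof.
elim: r => [|p r IHr] rD; first by rewrite big_nil; exact: spanned0.
rewrite big_cons; apply: spanned_linear; first by apply: rD; rewrite inE eqxx.
by apply: IHr => q qr; apply: rD; rewrite inE qr orbT.
Qed.

Lemma spanned_sub D D' x : {subset D <= D'} -> spanned D x -> spanned D' x.
Proof.
move=> DD'; elim=> [|a t y tD _ IHy]; first exact: spanned0.
by apply: spannedD => //; exact: DD'.
Qed.

Lemma spanned_orth D x z : (forall t, t \in D -> dot z (e t) = 0) -> spanned D x -> dot z x = 0.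
Proof.
move=> zD; elim=> [|a t y tD _ IHy]; first by rewrite dotC dot0l conjC0.
by rewrite dotDr dotZr zD // IHy mulr0 addr0.
Qed.

(** Repeated occurrences of an index are merged into one coefficient, which is how [ncspan]
    describes a span. *)
Lemma spanned_coef (s : seq T) x : uniq s -> spanned (mem s) x ->
  exists c : T -> C, x = \sum_(t <- s) c t *: e t.
Proof.
move=> us; elim=> [|a t y ts _ [c ->]].
  by exists (fun=> 0); rewrite big1 // => t _; rewrite scale0r.
exists (fun u => (if u == t then a else 0) + c u).
rewrite (bigD1_seq t) //= [in RHS](bigD1_seq t) //= eqxx scalerDl -addrA.
by congr (_ + (_ + _)); apply: eq_bigr => u /negbTE ->; rewrite add0r.
Qed.

(* The normalized component of [e t] orthogonal to [e u], [u \in D]. *)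
Definition unit_residual D t r := exists a q,
  [/\ 0 < a, spanned D q, r = a *: (e t - q),
      forall u, u \in D -> dot r (e u) = 0 & dot r r = 1].

Lemma unit_residual_eq D D' t r : D =i D' ->
  unit_residual D t r -> unit_residual D' t r.
Proof.
move=> DD' [a [q [a0 qD rE rD r1]]]; exists a, q; split=> //.
  by apply: spanned_sub qD => u; rewrite DD'.
by move=> u; rewrite -DD'; exact: rD.
Qed.

(** After rescaling, the difference of the two residuals lies in the span of [D] and is orthogonal
    to it, hence is 0; unit norms and positivity then force [a = a']. *)
Lemma unit_residual_unique D t r r' :
  unit_residual D t r -> unit_residual D t r' -> r = r'.
Proof.
move=> [a [q [a0 qD rE rD r1]]] [a' [q' [a'0 q'D r'E r'D r'1]]].
have an0 : a != 0 by rewrite gt_eqF.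
have a'n0 : a' != 0 by rewrite gt_eqF.
have hE : a^-1 *: r - a'^-1 *: r' = q' - q.
  rewrite rE r'E !scalerA !mulVf // !scale1r opprB addrC addrA subrK.
  by rewrite addrC.
have /dot_eq0/eqP : dot (a^-1 *: r - a'^-1 *: r') (a^-1 *: r - a'^-1 *: r') = 0.
  rewrite {2}hE; apply: (@spanned_orth D); last exact: spannedB.
  by move=> u uD; rewrite dotBl !dotZl rD // r'D // !mulr0 subr0.
rewrite subr_eq0 => /eqP rr'.
have := congr1 (fun x => dot x x) rr'; rewrite !dotZl !dotZr r1 r'1 !mulr1.
rewrite !(CrealP _) ?rpredV ?gtr0_real // -!expr2 => /eqP.
rewrite eqrXn2 ?invr_ge0 ?ltW // => /eqP/invr_inj aa'.
by move: rr'; rewrite aa' => /(scalerI (invr_neq0 a'n0)).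
Qed.

Lemma unit_residual_normalize D t q : spanned D q ->
  (forall u, u \in D -> dot (e t - q) (e u) = 0) -> e t - q != 0 ->
  unit_residual D t ((dnorm (e t - q))^-1 *: (e t - q)).
Proof.
move=> qD orth n0; exists (dnorm (e t - q))^-1, q; split => //.
- by rewrite invr_gt0 dnorm_gt0.
- by move=> u uD; rewrite dotZl orth // mulr0.
- exact: dnormalize.
Qed.

(** The loop body of [gram_schmidt] for an arbitrary inner product; for [mudot] the two agree by
    conversion. *)
Definition gram_schmidt_step (acc : seq V) x :=
  let y := x - \sum_(p <- acc) dot x p *: p in rcons acc ((dnorm y)^-1 *: y).

Section Independent.
Context (indep : forall D t, t \notin D -> ~ spanned D (e t)).

Lemma sub_spanned_neq0 D t q : t \notin D -> spanned D q -> e t - q != 0.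
Proof.
move=> tD qD; rewrite subr_eq0; apply/negP => /eqP eq.
by apply: (indep tD); rewrite eq.
Qed.

(* The second condition says that [acc] is orthonormal. *)
Lemma gram_schmidt_inv (s : seq T) : uniq s ->
  let acc := foldl gram_schmidt_step [::] (map e s) in
  [/\ forall p, p \in acc -> spanned (mem s) p,
      forall x p, p \in acc -> dot (x - \sum_(q <- acc) dot x q *: q) p = 0
    & forall z, (forall p, p \in acc -> dot z p = 0) ->
        forall t, t \in s -> dot z (e t) = 0].
Proof.
elim/last_ind: s => [|s t IHs]; first by split.
rewrite rcons_uniq => /andP[ts us].
rewrite map_rcons foldl_rcons; set acc := foldl _ _ _ in IHs *.
have [accD accO accE] := IHs us.
rewrite /gram_schmidt_step; set q := \sum_(p <- acc) _; set y := e t - q.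
have qD : spanned (mem s) q by exact: spanned_sum.
have y0 : y != 0 by exact: sub_spanned_neq0 qD.
set r := _ *: y.
have rO p : p \in acc -> dot r p = 0 by move=> pa; rewrite dotZl accO // mulr0.
have r1 : dot r r = 1 by exact: dnormalize.
have sub : {subset mem s <= mem (rcons s t)}.
  by move=> u us'; rewrite /= mem_rcons inE [u \in s]us' orbT.
split=> [p|x p|z zacc u].
- rewrite mem_rcons inE => /orP[/eqP->|/accD/(spanned_sub sub) //].
  rewrite -[r]addr0; apply: spanned_linear; last exact: spanned0.
  apply: spannedB; last exact: spanned_sub qD.
  by apply: spanned_gen; rewrite /= mem_rcons inE eqxx.
- rewrite -cats1 big_cat big_seq1 /= opprD addrA dotBl dotZl.
  rewrite mem_cat inE => /orP[pa|/eqP->]; first by rewrite accO // rO // mulr0 subr0.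
  rewrite r1 mulr1 dotBl dot_suml big_seq big1 ?subr0 ?subrr // => p' pa.
  by rewrite dotZl (dot_sym0 (rO _ pa)) mulr0.
have zs : forall v, v \in s -> dot z (e v) = 0.
  by apply: accE => p pa; apply: zacc; rewrite mem_rcons inE pa orbT.
rewrite mem_rcons inE => /orP[/eqP->|/zs //].
(* [e t] is [q] plus a nonzero multiple of [r], so orthogonality to [q] and [r] suffices. *)
have zq : dot z q = 0 by apply: spanned_orth qD.
have : dot z r = 0 by apply: zacc; rewrite mem_rcons inE eqxx.
rewrite dotZr dotBr zq subr0 => /eqP; rewrite mulf_eq0 conjC_eq0 invr_eq0.
by rewrite gt_eqF ?dnorm_gt0 //= => /eqP.
Qed.

Lemma gram_schmidt_last (s : seq T) t : uniq (rcons s t) ->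
  unit_residual (mem s) t (last 0 (foldl gram_schmidt_step [::] (map e (rcons s t)))).
Proof.
rewrite rcons_uniq => /andP[ts /gram_schmidt_inv].
rewrite map_rcons foldl_rcons; set acc := foldl _ _ _ => -[accD accO accE].
rewrite /gram_schmidt_step last_rcons.
have qD : spanned (mem s) (\sum_(p <- acc) dot (e t) p *: p) by exact: spanned_sum.
apply: unit_residual_normalize => //; last exact: sub_spanned_neq0 qD.
by apply: accE => p; exact: accO.
Qed.

(** The Fourier sum of [x] along the orthonormal list produced by Gram-Schmidt is its projection. *)
Lemma projection_exists (s : seq T) x : uniq s ->
  exists q, spanned (mem s) q /\ forall t, t \in s -> dot (x - q) (e t) = 0.
Proof.
move=> /gram_schmidt_inv; set acc := foldl _ _ _ => -[accD accO accE].
exists (\sum_(p <- acc) dot x p *: p); split; first exact: spanned_sum.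
by apply: accE => p; exact: accO.
Qed.

Section TwoResiduals.
Context (D : {pred T}) (t u : T) (tD : t \notin D) (tu : t != u).
Context (x y : V) (rx : unit_residual D t x) (ry : unit_residual D u y).

(* One step of the Szego-type recursion: adding [u] to the span rotates the
   residual of [e t]. *)
Lemma unit_residual_step : `|dot x y| < 1 /\
  unit_residual [predU1 u & D] t ((sqrtC (1 - `|dot x y| ^+ 2))^-1 *: (x - dot x y *: y)).
Proof.
have [a [p [a0 pD xE xD x1]]] := rx; have [b [q [b0 qD yE yD y1]]] := ry.
set g := dot x y; set z := x - g *: y.
have an0 : a != 0 by rewrite gt_eqF.
have sub : {subset D <= [predU1 u & D]} by move=> v; rewrite inE orbC => ->.
(* Solves [x - g *: y = a *: (e t - h)] for [h], with [x = a *: (e t - p)] and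
   [y = b *: (e u - q)]. *)
pose h := p + (a^-1 * g * b) *: (e u - q).
have hD : spanned [predU1 u & D] h.
  rewrite /h addrC; apply: spanned_linear; last exact: spanned_sub pD.
  apply: spannedB; last exact: spanned_sub qD.
  by apply: spanned_gen; rewrite inE eqxx.
have zE : z = a *: (e t - h).
  rewrite /z /h [in LHS]yE {1}xE scalerA opprD addrA [RHS]scalerBr scalerA.
  by rewrite !mulrA mulfV // mul1r.
have z0 : z != 0.
  rewrite zE scaler_eq0 (negbTE an0) /=; apply: sub_spanned_neq0 hD.
  by rewrite inE negb_or tu.
(* Pythagoras, [g *: y] being the projection of [x] on the unit vector [y]; as [z != 0], this yields
   [|g| < 1]. *)
have zz : dot z z = 1 - `|g| ^+ 2.
  rewrite !(dotBl, dotBr, dotZl, dotZr) x1 y1 (dotC x) -/g normCK; ring.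
have g1 : 0 < 1 - `|g| ^+ 2 by rewrite -zz dot_gt0.
split.
  rewrite -(@ltr_pXn2r _ 2) ?nnegrE ?ler01 ?normr_ge0 //.
  by rewrite expr1n -subr_gt0.
rewrite -zz; exists ((sqrtC (dot z z))^-1 * a), h; split => //.
- by rewrite mulr_gt0 // invr_gt0 sqrtC_gt0 zz.
- by rewrite zE scalerA.
(* [z] is orthogonal to [y] and to the span of [D], and [e u] is a combination of [y] and of [q],
   which lies in that span. *)
- have zy : dot z y = 0 by rewrite dotBl dotZl y1 mulr1 subrr.
  have zDv v : v \in D -> dot z (e v) = 0.
    by move=> vD; rewrite dotBl dotZl xD // yD // mulr0 subr0.
  have zu : dot z (e u) = 0.
    have -> : e u = b^-1 *: y + q.
      by rewrite yE scalerA mulVf ?gt_eqF // scale1r subrK.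
    by rewrite dotDr dotZr zy (spanned_orth zDv qD) mulr0 addr0.
  by move=> v; rewrite dotZl inE => /orP[/eqP->|/zDv ->]; rewrite ?zu mulr0.
exact: dnormalize.
Qed.

End TwoResiduals.
End Independent.
End Family.
End Theory.
End InnerProduct.

(** * The inner product of an nc measure *)

Section NCMeasure.
Context (R : realType) (d : nat) (mu : operator R d -> R[i]).
Context (mu_measure : nc_measure mu).
Implicit Types (P Q S : ncpoly R d) (s t w : word d).

Lemma disc_system_poly P Q : disc_system (adjoint (poly_op Q) \o poly_op P).
Proof. exact/poly_system_sub/poly_system_poly. Qed.

Lemma mudot_linearl (a : R[i]) P Q S :
  mudot mu (a *: P + Q) S = a * mudot mu P S + mudot mu Q S.
Proof.
rewrite /mudot -(mu_measure.1 _ _ _ (disc_system_poly P S) (disc_system_poly Q S)).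
congr mu; apply/funext => f; rewrite poly_op_linear.
have [/is_adjoint_sym adjS _ _] := poly_op_adjointable S.
exact: (is_adjoint_lin adjS).
Qed.

Lemma mudot_linearr (a : R[i]) P Q S :
  mudot mu S (a *: P + Q) = a^* * mudot mu S P + mudot mu S Q.
Proof.
rewrite /mudot -(mu_measure.1 _ _ _ (disc_system_poly S P) (disc_system_poly S Q)).
by rewrite adjoint_poly_op.
Qed.

Lemma mudot_ge0 P : 0 <= mudot mu P P.
Proof.
apply: mu_measure.2; first exact: disc_system_poly.
move=> f /=; have [/is_adjoint_sym adjP _ _] := poly_op_adjointable P.
by rewrite adjP hdot_ge0.
Qed.

(** Positivity makes every [mudot mu S S] real, which polarization turns into Hermitian symmetry. *)
Lemma mudotC P Q : mudot mu Q P = (mudot mu P Q)^*.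
Proof.
apply: (sesquilinear_real_hermitian mudot_linearl mudot_linearr) => S.
by apply/CrealP/ger0_real/mudot_ge0.
Qed.

Lemma mudot_ncvar j k P Q :
  mudot mu (ncvar R k * P) (ncvar R j * Q) = if j == k then mudot mu P Q else 0.
Proof.
have mu0 : mu 0 = 0.
  have ds0 := poly_system_sub (poly_system0 R d).
  have := mu_measure.1 1 0 0 ds0 ds0; rewrite scale1r addr0 mul1r => /eqP.
  by rewrite -[X in X == _]addr0 (inj_eq (addrI _)) => /eqP.
rewrite /mudot adjoint_poly_op_ncvar poly_op_ncvar.
have -> : (adjoint (poly_op Q) \o back_shift j) \o (left_shift k \o poly_op P) =
    adjoint (poly_op Q) \o (back_shift j \o left_shift k) \o poly_op P by [].
rewrite back_shiftK; case: (j == k); first by rewrite scale1r.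
rewrite scale0r -mu0; congr mu; apply/funext => f /=.
by have [/is_adjoint_sym/is_adjoint_op0 ->] := poly_op_adjointable Q.
Qed.

Lemma moment_kernelE s t : moment_kernel mu s t = mudot mu (ncmonom R s) (ncmonom R t).
Proof. by rewrite /mudot !poly_op_monom. Qed.

Lemma mudot_monomr P t :
  mudot mu P (ncmonom R t) = \sum_(w <- msupp P) mcoeff w P * moment_kernel mu w t.
Proof.
rewrite {1}[P]ncpolyE.
have h0 : mudot mu 0 (ncmonom R t) = 0.
  have := mudot_linearl 1 0 0 (ncmonom R t); rewrite scale1r addr0 mul1r => /eqP.
  by rewrite -[X in X == _]addr0 (inj_eq (addrI _)) => /eqP.
elim/big_rec2: _ => // w x S _ <-.
by rewrite mudot_linearl moment_kernelE.
Qed.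

Lemma preceding_uniq w : uniq (preceding w).
Proof.
exact: sorted_uniq (@shortlex_trans d) (@shortlex_irr d) _ (preceding_sorted w).
Qed.

(** A [P] of norm 0 is orthogonal to all monomials, so its coefficients form a row vector killed by
    a moment matrix, which is invertible. *)
Lemma mudot_gt0 : nontrivial mu -> forall P, P != 0 -> 0 < mudot mu P P.
Proof.
move=> nt P Pn0; rewrite lt_def mudot_ge0 andbT; apply/eqP => P0.
have null := sesquilinear_null mudot_linearl mudotC mudot_ge0 P0.
(* Larger than every length in the support of [P], so that all words of the support are in [s]. *)
pose N := (\max_(w <- msupp P) size (w : word d)).+1.
pose s0 := last_word d N; pose s := rcons (preceding s0) s0.
have Kunit : \matrix_(i < size s, j < size s)
    moment_kernel mu (nth [::] s i) (nth [::] s j) \in unitmx by exact: nt s0.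
have us : uniq s by rewrite rcons_uniq mem_preceding shortlex_irr preceding_uniq.
have Ps (w : fmonom 'I_d.+1) : w \in msupp P -> (w : word d) \in s.
  move=> wP; rewrite mem_rcons inE mem_preceding /shortlex size_nseq ltnS.
  apply/orP; right; apply/orP; left.
  by rewrite (big_rem w) //= leq_maxl.
clearbody s; pose c := \row_(i < size s) mcoeff (FMonom (nth [::] s i)) P.
have cK : c *m \matrix_(i < size s, j < size s)
    moment_kernel mu (nth [::] s i) (nth [::] s j) = 0.
  apply/rowP => j; transitivity (mudot mu P (ncmonom R (nth [::] s j))).
    2: by rewrite null mxE.
  rewrite mudot_monomr mxE.
  under eq_bigr do rewrite !mxE.
  (* The sum over matrix indices becomes a sum over the words in [s], then over the support of [P],
     outside which the coefficients vanish. *)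
  rewrite -(big_mkord xpredT (fun i => mcoeff (FMonom (nth [::] s i)) P *
    moment_kernel mu (nth [::] s i) (nth [::] s j))).
  rewrite -(big_nth [::] xpredT (fun w => mcoeff (FMonom w) P *
    moment_kernel mu w (nth [::] s j))).
  rewrite -(big_map (@FMonom _) xpredT (fun w : fmonom 'I_d.+1 => mcoeff w P *
    moment_kernel mu w (nth [::] s j))) (bigID (fun w : fmonom 'I_d.+1 => w \in msupp P)) /=.
  rewrite [X in _ + X]big1 ?addr0 => [|w /mcoeff_outdom ->]; last by rewrite mul0r.
  rewrite -big_filter; apply: perm_big; apply: uniq_perm.
  - by rewrite filter_uniq // map_inj_uniq // => u v [].
  - exact: fset_uniq.
  move=> w; rewrite mem_filter; case: (boolP (w \in msupp P)) => //= /Ps ws.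
  by apply/mapP; exists (w : word d) => //; rewrite fmK.
have c0 : c = 0 by rewrite -[c](mulmxK Kunit) cK mul0mx.
move/eqP: Pn0; apply; apply/malgP => w; rewrite mcoeff0.
case: (boolP (w \in msupp P)) => [/Ps ws|/mcoeff_outdom //].
move/rowP: c0 => /(_ (Ordinal (etrans (index_mem _ _) ws))).
by rewrite !mxE /= nth_index // fmK.
Qed.

End NCMeasure.

(** * Recurrences for the orthonormal polynomials *)

Section SzegoRecurrence.
Context (R : realType) (d : nat) (mu : operator R d -> R[i]).
Context (mu_measure : nc_measure mu) (mu_probability : probability_measure mu).
Context (mu_nontrivial : nontrivial mu).
Implicit Types (P Q x y : ncpoly R d) (s t w : word d).

Local Notation residual D t r :=
  (@unit_residual R[i] (ncpoly R d) (mudot mu) (word d) (@ncmonom R d) D t r).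
Local Notation spanned := (@spanned R[i] (ncpoly R d) (word d) (@ncmonom R d)).

Lemma mudot_inner_product : @inner_product R[i] (ncpoly R d) (mudot mu).
Proof.
split=> [a P Q S|P Q|P]; first exact: mudot_linearl.
- exact: mudotC.
- exact: mudot_gt0.
Qed.
Let ip := mudot_inner_product.

(** The coefficient at [FMonom t] vanishes on the span of the monomials indexed by [D]. *)
Lemma ncmonom_independent (D : {pred word d}) t :
  t \notin D -> ~ spanned D (ncmonom R t).
Proof.
move=> tD h; suff : mcoeff (FMonom t) (ncmonom R t) = 0 :> R[i].
  by rewrite mcoeff_monom eqxx => /eqP; rewrite oner_eq0.
elim: h => [|a u x uD _ IHx]; first exact: mcoeff0.
rewrite (mcoeffD (FMonom t) (a *: ncmonom R u)) (mcoeffZ a (ncmonom R u)) IHx addr0.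
rewrite (mcoeff_monom R u t) (_ : u == t = false) ?mulr0 //.
by apply: contraNF tD => /eqP <-.
Qed.
Let indep := ncmonom_independent.

Lemma orthopoly_residual w :
  residual (mem (preceding w)) w (orthopoly mu w).
Proof.
apply: (gram_schmidt_last ip indep).
by rewrite rcons_uniq mem_preceding shortlex_irr preceding_uniq.
Qed.

(** Since a projection exists, [xget] returns one instead of falling back on 0. *)
Lemma muprojP (r : seq (word d)) P : uniq r ->
  spanned (mem r) (muproj mu r P) /\
  forall t, t \in r -> mudot mu (P - muproj mu r P) (ncmonom R t) = 0.
Proof.
move=> ur; have [Q [Qr QO]] := projection_exists ip indep P ur.
have [|[c cE] orth] := @xgetPex _ (0 : ncpoly R d) [set Q | ncspan r Q /\
    forall w, w \in r -> mudot mu (P - Q) (ncmonom R w) = 0].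
  by exists Q; split => //; exact: spanned_coef Qr.
split=> //; rewrite /muproj cE big_seq; elim/big_rec: _ => [|w S wr IHS].
  exact: spanned0.
exact: spannedD.
Qed.

(** The words indexing the span that is projected out in [verblunsky mu w]. *)
Definition between w : {pred word d} := [pred t | (t != [::]) && shortlex t w].

(** [verblunsky] is formed from the components of [Z^w] and 1 orthogonal to the words in between;
    uniqueness of residuals identifies these components, once normalized, with [x] and [y]. *)
Lemma verblunskyE w x y : w != [::] ->
  residual (between w) w x -> residual (between w) [::] y ->
  verblunsky mu w = mudot mu x y.
Proof.
move=> w0 rx ry; pose r := [seq t <- preceding w | t != [::]].
have ur : uniq r by rewrite filter_uniq // preceding_uniq.
have rE : mem r =i between w by move=> t; rewrite /= mem_filter mem_preceding.
have norm t z : t \notin between w -> residual (between w) t z ->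
    let v := ncmonom R t - muproj mu r (ncmonom R t) in
    munorm mu v != 0 /\ v = munorm mu v *: z.
  move=> tw rz v; have [vr vO] := muprojP (ncmonom R t) ur.
  have v0 : v != 0.
    apply: (sub_spanned_neq0 indep tw); apply: spanned_sub vr => u.
    by rewrite -rE.
  have n0 : munorm mu v != 0 by rewrite gt_eqF //; exact: (dnorm_gt0 ip).
  split=> //; have := unit_residual_normalize ip vr vO v0.
  move=> /(unit_residual_eq rE)/(unit_residual_unique ip rz) ->.
  by rewrite scalerA mulfV // scale1r.
have [|nx xE] := norm w x _ rx; first by rewrite inE shortlex_irr andbF.
have [|ny yE] := norm [::] y _ ry; first by rewrite inE.
set X := ncmonom R w - _ in nx xE; set Y := ncmonom R [::] - _ in ny yE.
have -> : verblunsky mu w = mudot mu X Y / (munorm mu X * munorm mu Y).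
  by rewrite /X /Y /r ncmonom0; case: (w) w0.
clearbody X Y; rewrite {1}xE {1}yE (dotZl ip) (dotZr ip).
have nY : (munorm mu Y)^* = munorm mu Y.
  by apply/CrealP/ger0_real; rewrite sqrtC_ge0; exact: mudot_ge0.
rewrite nY; move: (munorm mu X) (munorm mu Y) (mudot mu x y) nx ny => a b c a0 b0.
by rewrite mulrA [LHS]mulrAC divff ?mul1r // mulf_neq0.
Qed.

Lemma shortlex_cons k s t : shortlex (k :: s) (k :: t) = shortlex s t.
Proof. by rewrite /shortlex /= ltnS eqSS ltxi_cons lexx. Qed.

Lemma wpred_ind (K : word d -> Prop) :
  K [::] -> (forall k s, K (wpred (k :: s)) -> K (k :: s)) -> forall w, K w.
Proof.
move=> K0 KS w; have [n] := ubnP (size (preceding w)); elim: n w => // n IHn.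
case=> // k s; rewrite preceding_wpred // size_rcons ltnS => /IHn.
exact: KS.
Qed.

Lemma shortlex_wpred t w : w != [::] ->
  shortlex t w = (t == wpred w) || shortlex t (wpred w).
Proof.
by move=> w0; rewrite -!mem_preceding (preceding_wpred w0) mem_rcons inE.
Qed.

(** Multiplication by [Z_k] preserves inner products and carries the words before [s] to the words
    before [k s] that start with [k]; nonempty words starting with another letter are orthogonal to
    its range. *)
Lemma ncvar_orthopoly_residual k s :
  residual (between (k :: s)) (k :: s) (ncvar R k * orthopoly mu s).
Proof.
have [a [q [a0 qs pE pO p1]]] := orthopoly_residual s.
exists a, (ncvar R k * q); split; first exact: a0.
- elim: qs => [|b t z ts _ IHz]; first by rewrite mulr0; exact: spanned0.
  rewrite mulrDr ncvar_scaleAr ncvarM; apply: spannedD IHz.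
  by rewrite inE /= shortlex_cons -mem_preceding.
- rewrite pE.
  transitivity (a *: (ncvar R k * ncmonom R s - ncvar R k * q)).
    exact: ncvar_scale_sub.
  congr (a *: (_ - _)).
  exact: ncvarM.
- case=> // j u; rewrite inE /= => ju; rewrite -ncvarM (mudot_ncvar mu_measure).
  case: eqP ju => // ->; rewrite shortlex_cons -mem_preceding; exact: pO.
by rewrite (mudot_ncvar mu_measure) eqxx.
Qed.

Lemma betweenS w : w != [::] ->
  [predU1 w & between w] =i [pred t | (t != [::]) && ((t == w) || shortlex t w)].
Proof. by move=> w0 t; rewrite !inE; case: eqP => [->|]; rewrite ?w0. Qed.

(** Passing from [wpred w] to [w] adds [w] to the span, and [unit_residual_step] with [u = w] then
    reproduces the recurrence defining [reverse_poly]. *)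
Lemma reverse_poly_residual w :
  residual [pred t | (t != [::]) && ((t == w) || shortlex t w)] [::]
    (reverse_poly mu w).
Proof.
elim/wpred_ind: w => [|k s IHw].
  rewrite reverse_poly_nil -ncmonom0; exists 1, 0; split => //.
  - exact: spanned0.
  - by rewrite subr0 scale1r.
  - by case.
  (* The polynomial 1 has norm 1 because [mu] is a probability measure. *)
  rewrite /mudot poly_op_monom; rewrite -[RHS]mu_probability; congr mu.
  by apply/funext => f; rewrite /= (adjointE (@is_adjoint_id R d)).
set w := k :: s in IHw *.
have {}IHw : residual (between w) [::] (reverse_poly mu (wpred w)).
  by apply: unit_residual_eq IHw => t; rewrite !inE (shortlex_wpred t (w := w)).
have X := ncvar_orthopoly_residual k s.
have g := verblunskyE (isT : w != [::]) X IHw.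
have nb : [::] \notin between w by rewrite inE.
(* With the residual of 1 in first position, the rotation coefficient is the conjugate of
   [verblunsky mu w]. *)
have [_] := unit_residual_step ip indep nb (isT : [::] != w) IHw X.
rewrite (mudotC mu_measure) -g norm_conjC => /(unit_residual_eq (betweenS (isT : w != [::]))).
by rewrite subZ_swap -(reverse_poly_cons mu k s).
Qed.

Lemma reverse_poly_wpred_residual w : w != [::] ->
  residual (between w) [::] (reverse_poly mu (wpred w)).
Proof.
move=> w0; apply: unit_residual_eq (reverse_poly_residual (wpred w)) => t.
by rewrite !inE (shortlex_wpred t w0).
Qed.

(** The same rotation with the roles exchanged: adding the empty word to [between w] gives all words
    preceding [w], and [Z_k phi_s] turns into the residual that is [orthopoly mu w]. *)
Lemma orthopoly_cons k s : let w := k :: s in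
  `|verblunsky mu w| < 1 /\
  orthopoly mu w = (sqrtC (1 - `|verblunsky mu w| ^+ 2))^-1 *:
    (ncvar R k * orthopoly mu s - verblunsky mu w *: reverse_poly mu (wpred w)).
Proof.
move=> w; have X := ncvar_orthopoly_residual k s.
have Y := reverse_poly_wpred_residual (isT : w != [::]).
have wb : w \notin between w by rewrite inE shortlex_irr andbF.
rewrite (verblunskyE (isT : w != [::]) X Y).
have [g1 res] := unit_residual_step ip indep wb (isT : w != [::]) X Y; split=> //.
apply: (unit_residual_unique ip (orthopoly_residual w)).
apply: unit_residual_eq res => t; rewrite -[RHS]/(t \in preceding w) mem_preceding !inE.
by case: eqP => [->|].
Qed.

Lemma orthopoly_nil : orthopoly mu [::] = 1.
Proof.
apply: (unit_residual_unique ip (orthopoly_residual [::])).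
rewrite -(reverse_poly_nil mu); apply: unit_residual_eq (reverse_poly_residual [::]).
by move=> t; rewrite -[RHS]/(t \in preceding [::]) mem_preceding inE; case: t.
Qed.

End SzegoRecurrence.

(** * Evaluation at matrices *)

Section WordSums.
Context (d : nat).
Implicit Types (s t w : word d) (n : nat).

Lemma last_word_max n t : size t = n ->
  (t == last_word d n) || shortlex t (last_word d n).
Proof.
move=> tn; rewrite /shortlex size_nseq tn eqxx ltnn /= lt_neqAle.
have -> : ((t : seqlexi 'I_d.+1) <= (last_word d n : seqlexi 'I_d.+1))%O.
  elim: n t tn => [|n IHn] [|k s] //= [sn]; rewrite lexi_cons IHn // implybT andbT.
  by rewrite leEord /= -ltnS.
by rewrite andbT orbN.
Qed.

Lemma shortlex_size s t : shortlex s t -> (size s <= size t)%N.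
Proof. by case/orP => [/ltnW|/andP[/eqP->]]. Qed.

Lemma words_uniq n : uniq (words d n).
Proof.
exact: sorted_uniq (@shortlex_trans d) (@shortlex_irr d) _ (words_sorted d n).
Qed.

(** [last_word d n] precedes [w], hence is at most [wpred w], and no word of length [n] comes after
    it. *)
Lemma wpred_size n w : size w = n.+1 ->
  size (wpred w) = n.+1 \/ wpred w = last_word d n.
Proof.
move=> wn; have w0 : w != [::] by case: w wn.
have pw : shortlex (wpred w) w by rewrite (shortlex_wpred _ w0) eqxx.
have := shortlex_size pw; rewrite wn leq_eqVlt => /orP[/eqP|]; first by left.
rewrite ltnS => pn; right.
have lw : shortlex (last_word d n) w by rewrite /shortlex size_nseq wn ltnSn.
move: lw; rewrite (shortlex_wpred _ w0) => /orP[/eqP //|lp].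
have /last_word_max : size (wpred w) = n.
  by apply/eqP; rewrite eqn_leq pn; have := shortlex_size lp; rewrite size_nseq.
by case/orP => [/eqP //|pl]; have := shortlex_trans lp pl; rewrite shortlex_irr.
Qed.

(** The sum telescopes along the shortlex order; the predecessor of the first word of length [n.+1]
    is [last_word d n]. *)
Lemma sum_words_last (V : zmodType) (F : word d -> V) n :
  \sum_(w <- words d n.+1) (F w - F (wpred w)) =
  F (last_word d n.+1) - F (last_word d n).
Proof.
(* For the induction, the sum is cut off at an arbitrary word [w] of length [n.+1]. *)
have H w : size w = n.+1 -> \sum_(t <- words d n.+1 | (t == w) || shortlex t w)
    (F t - F (wpred t)) = F w - F (last_word d n).
  elim/wpred_ind: w => // k s; set w := k :: s => IHw wn.
  rewrite big_mkcond (bigD1_seq w) ?words_uniq ?mem_words ?wn // ifT ?eqxx //.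
  rewrite -big_mkcondr (eq_bigl (fun t => (t == wpred w) || shortlex t (wpred w))).
    2: by move=> t; rewrite -(shortlex_wpred t (isT : w != [::]));
      case: eqP => [->|]; rewrite ?shortlex_irr.
  have [/IHw ->|->] := wpred_size wn; first by rewrite [LHS]/= addrA subrK.
  (* Here [w] is the first word of its length, and the remaining sum is empty. *)
  rewrite big1_seq => [|t /andP[tl]]; first exact: addr0.
  rewrite mem_words => /eqP tn.
  have : (size t <= n)%N.
    by case/orP: tl => [/eqP ->|/shortlex_size]; rewrite size_nseq.
  by rewrite tn ltnn.
rewrite -H ?size_nseq // [LHS]big_seq_cond [RHS]big_seq_cond; apply: eq_bigl => t.
by rewrite mem_words; case: eqP => //= /last_word_max ->.
Qed.

Lemma sum_words_cons (V : nmodType) (F : word d -> V) n :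
  \sum_(w <- words d n.+1) F w = \sum_k \sum_(s <- words d n) F (k :: s).
Proof. by rewrite /= big_allpairs_dep big_enum. Qed.

Lemma sum_tuple_words (V : nmodType) (F : word d -> V) n :
  \sum_(s : n.-tuple 'I_d.+1) F s = \sum_(s <- words d n) F s.
Proof.
transitivity (\sum_(s <- map val (enum {: n.-tuple 'I_d.+1})) F s).
  by rewrite big_map big_enum.
apply: perm_big; apply: uniq_perm.
- by rewrite map_inj_uniq ?enum_uniq //; exact: val_inj.
- exact: words_uniq.
move=> s; rewrite mem_words; apply/mapP/idP => [[t _ ->]|sn]; first by rewrite size_tuple eqxx.
by exists (Tuple sn); rewrite ?mem_enum.
Qed.

End WordSums.

(** * Quadratic forms and invertibility of matrices *)

Section QuadraticForms.
Context (C : numClosedFieldType) (m : nat).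
Implicit Types (M N : 'M[C]_m.+1) (v : 'cV[C]_m.+1).

Lemma adjmxK (p q : nat) (A : 'M[C]_(p, q)) : (A^t*)^t* = A.
Proof. by apply/matrixP => i j; rewrite !mxE conjCK. Qed.

Lemma adjmxM (p q r : nat) (A : 'M[C]_(p, q)) (B : 'M[C]_(q, r)) :
  (A *m B)^t* = B^t* *m A^t*.
Proof. by rewrite trmx_mul map_mxM. Qed.

Definition qform M v : C := (v^t* *m M *m v) 0 0.

Lemma qformD M N v : qform (M + N) v = qform M v + qform N v.
Proof. by rewrite /qform mulmxDr mulmxDl mxE. Qed.

Lemma qform_sum (I : Type) (r : seq I) (F : I -> 'M[C]_m.+1) v :
  qform (\sum_(i <- r) F i) v = \sum_(i <- r) qform (F i) v.
Proof. by rewrite /qform mulmx_sumr mulmx_suml summxE. Qed.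

Lemma qform_conj M N v : qform (N^t* *m M *m N) v = qform M (N *m v).
Proof. by rewrite /qform adjmxM !mulmxA. Qed.

Lemma qform_gram N v : qform (N^t* *m N) v = qform 1%:M (N *m v).
Proof. by rewrite -qform_conj mulmx1. Qed.

Lemma qform1E v : qform 1%:M v = \sum_i `|v i 0| ^+ 2.
Proof.
by rewrite /qform mulmx1 mxE; apply: eq_bigr => i _; rewrite !mxE normCKC.
Qed.

Lemma qform1_ge0 v : 0 <= qform 1%:M v.
Proof. by rewrite qform1E sumr_ge0 // => i _; rewrite exprn_ge0. Qed.

Lemma qform1_eq0 v : qform 1%:M v = 0 -> v = 0.
Proof.
rewrite qform1E => /eqP; rewrite psumr_eq0; last by move=> i _; rewrite exprn_ge0.
move=> /allP v0; apply/matrixP => i j; rewrite ord1 mxE.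
have := v0 i; rewrite mem_index_enum expf_eq0 normr_eq0 /= => /(_ isT)/eqP.
exact.
Qed.

Lemma qform0 M : qform M 0 = 0.
Proof. by rewrite /qform mulmx0 mxE. Qed.

Lemma unitmx_mulmx_inj M : (forall v, M *m v = 0 -> v = 0) -> M \in unitmx.
Proof.
move=> inj; rewrite -unitmx_tr -row_free_unit -kermx_eq0; apply/eqP.
apply/row_matrixP => i; rewrite row0; apply: trmx_inj; rewrite trmx0; apply: inj.
by rewrite -{1}[M]trmxK -trmx_mul -row_mul mulmx_ker row0 trmx0.
Qed.

End QuadraticForms.

(** * Matrix families [p], [q] satisfying the recurrences *)

Section RecurrenceEvaluation.
Context (C : numClosedFieldType) (d m : nat).
Context (X : 'I_d.+1 -> 'M[C]_m.+1) (p q : word d -> 'M[C]_m.+1) (g : word d -> C).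
Context (p0 : p [::] = 1%:M) (q0 : q [::] = 1%:M).
Context (g1 : forall w, `|g w| < 1).
Local Notation rho w := (sqrtC (1 - `|g w| ^+ 2))^-1.
Context (pS : forall k s, let w := k :: s in
  p w = rho w *: (X k *m p s - g w *: q (wpred w))).
Context (qS : forall k s, let w := k :: s in
  q w = rho w *: (q (wpred w) - (g w)^* *: (X k *m p s))).
Implicit Types (s t w : word d) (n : nat) (v : 'cV[C]_m.+1).
Let G := \sum_k (X k)^t* *m X k.

Lemma rhoE w : 0 < rho w /\ rho w * rho w * (1 - g w * (g w)^*) = 1.
Proof.
have r0 : 0 < 1 - `|g w| ^+ 2 by rewrite subr_gt0 expr_lt1.
split; first by rewrite invr_gt0 sqrtC_gt0.
by rewrite -normCK -{3}[1 - _]sqrtCK -invfM -expr2 mulVf // expf_neq0 // gt_eqF // sqrtC_gt0.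
Qed.

(* The recurrence acts on the pair by a matrix preserving diag(1, -1). *)
Lemma gram_step k s : let w := k :: s in
  (q w)^t* *m q w - (q (wpred w))^t* *m q (wpred w) =
  (p w)^t* *m p w - (p s)^t* *m ((X k)^t* *m X k) *m p s.
Proof.
move=> w; have [c0 cE] := rhoE w; rewrite (qS k s) (pS k s) -/w.
set a := X k *m p s; set b := q (wpred w).
have -> : (p s)^t* *m ((X k)^t* *m X k) *m p s = a^t* *m a.
  by rewrite /a adjmxM !mulmxA.
have cr : (rho w)^* = rho w by apply/CrealP/gtr0_real.
move: (rho w) {c0} cr cE => c cr cE; move: (g w) a b cE => h a b cE.
have adjZ (e : C) (M : 'M[C]_m.+1) : (e *: M)^t* = e^* *: M^t*.
  by apply/matrixP => i j; rewrite !mxE rmorphM.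
have adjB (M N : 'M[C]_m.+1) : (M - N)^t* = M^t* - N^t*.
  by apply/matrixP => i j; rewrite !mxE rmorphB.
rewrite !(adjZ, adjB, cr, conjCK) -!(scalemxAl, scalemxAr) !(mulmxBl, mulmxBr).
rewrite -!(scalemxAl, scalemxAr).
move: (a^t* *m a) (a^t* *m b) (b^t* *m a) (b^t* *m b) => aa ab ba bb.
apply/matrixP => i j; rewrite !mxE.
move: (aa i j) (ab i j) (ba i j) (bb i j) (h^*) cE => x y z t h' cE.
(* The mixed terms cancel: the difference of the two sides is a multiple of [c^2 (1 - |h|^2) - 1],
   which is 0. *)
apply/eqP; rewrite -subr_eq0; apply/eqP.
transitivity ((c * c * (1 - h * h') - 1) * (t - x)); first by ring.
by rewrite cE subrr mul0r.
Qed.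

Lemma gram_telescope n : (q (last_word d n))^t* *m q (last_word d n) =
  \sum_(w <- words d n) (p w)^t* *m p w +
  \sum_(i < n) \sum_(s <- words d i) (p s)^t* *m (1%:M - G) *m p s.
Proof.
elim: n => [|n IHn]; first by rewrite big_ord0 addr0 big_seq1 p0 q0.
pose Q w := (q w)^t* *m q w; have := sum_words_last Q n.
(* [gram_step] is summed over the words of length [n.+1], grouped by first letter; summing
   [X_k^* X_k] over [k] produces [G]. *)
have step : \sum_k \sum_(s <- words d n) (Q (k :: s) - Q (wpred (k :: s))) =
    \sum_(w <- words d n.+1) (p w)^t* *m p w -
    \sum_(s <- words d n) (p s)^t* *m G *m p s.
  rewrite (sum_words_cons (fun w => (p w)^t* *m p w)).
  transitivity (\sum_k \sum_(s <- words d n) ((p (k :: s))^t* *m p (k :: s) -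
      (p s)^t* *m ((X k)^t* *m X k) *m p s)).
    by do 2 (apply: eq_bigr => ? _); exact: gram_step.
  rewrite [X in _ - X](_ : _ = \sum_k \sum_(s <- words d n)
      (p s)^t* *m ((X k)^t* *m X k) *m p s).
    by rewrite -sumrB; apply: eq_bigr => k _; exact: sumrB.
  rewrite exchange_big; apply: eq_bigr => s _ /=.
  by rewrite /G mulmx_sumr mulmx_suml.
rewrite [Q (last_word d n)]IHn sum_words_cons step => /eqP.
rewrite eq_sym subr_eq => /eqP; rewrite {1}/Q => ->.
rewrite big_ord_recr [X in _ = _ + X]/=.
set B := \sum_(w <- words d n) (p w)^t* *m p w; set E := \sum_(s <- words d n) _ *m G *m _.
set D := \sum_(i < n) _; set Dn := \sum_(s <- words d n) _ *m (_ - G) *m _.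
have -> : Dn = B - E.
  rewrite /Dn /B /E -sumrB; apply: eq_bigr => s _ /=.
  by rewrite mulmxBr mulmx1 mulmxBl.
by rewrite -[LHS]addrA [D + _]addrC -[in RHS]addrA; congr (_ + _); rewrite addrCA.
Qed.

Local Notation A n := ((q (last_word d n))^t* *m q (last_word d n)).
Local Notation B n := (\sum_(w <- words d n) (p w)^t* *m p w).

Lemma qform_gram_ge0 (N : 'M[C]_m.+1) v : 0 <= qform (N^t* *m N) v.
Proof. by rewrite qform_gram qform1_ge0. Qed.

(** Since [p [::] = 1], the empty word contributes [qform H v > 0]; the other terms are
    nonnegative. *)
Lemma sum_qform_gt0 (H : 'M[C]_m.+1) n v : (forall u, u != 0 -> 0 < qform H u) -> v != 0 ->
  (0 < n)%N -> 0 < qform (\sum_(i < n) \sum_(s <- words d i) (p s)^t* *m H *m p s) v.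
Proof.
move=> Hpos v0; have H0 u : 0 <= qform H u.
  by have [->|/Hpos/ltW //] := eqVneq u 0; rewrite qform0.
case: n => // n _; rewrite big_ord_recl qformD /= big_seq1.
apply: ltr_wpDr; last by rewrite qform_conj p0 mul1mx Hpos.
rewrite qform_sum sumr_ge0 // => i _; rewrite qform_sum sumr_ge0 // => s _.
by rewrite qform_conj.
Qed.

Lemma unitmx_qform (N : 'M[C]_m.+1) : (forall v : 'cV[C]_m.+1, v != 0 -> qform N v != 0) -> N \in unitmx.
Proof.
move=> N0; apply: unitmx_mulmx_inj => v Nv; apply/eqP; apply: contraT => /N0.
by rewrite /qform -mulmxA Nv mulmx0 mxE eqxx.
Qed.

Lemma reverse_unitmx n : (forall u, u != 0 -> 0 < qform (1%:M - G) u) ->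
  A n \in unitmx.
Proof.
(* For [n = 0] the double sum in [gram_telescope] is empty, but the matrix is the identity. *)
move=> Gpos; case: n => [|n].
  by rewrite q0 mulmx1 unitmxE det_map_mx det_tr det1 rmorph1 unitr1.
apply: unitmx_qform => v v0; rewrite gram_telescope qformD gt_eqF //.
apply: ltr_wpDl; last exact: sum_qform_gt0.
by rewrite qform_sum sumr_ge0 // => w _; exact: qform_gram_ge0.
Qed.

Lemma direct_unitmx n : (forall u, u != 0 -> 0 < qform (G - 1%:M) u) ->
  B n \in unitmx.
Proof.
move=> Gpos; case: n => [|n].
  by rewrite big_seq1 p0 mulmx1 unitmxE det_map_mx det_tr det1 rmorph1 unitr1.
(* [gram_telescope] solved for the sum over the longest words, which reverses the sign of
   [1 - G]. *)
have -> : B n.+1 = A n.+1 +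
    \sum_(i < n.+1) \sum_(s <- words d i) (p s)^t* *m (G - 1%:M) *m p s.
  rewrite gram_telescope -addrA -[LHS]addr0; congr (_ + _).
  rewrite -big_split big1 // => i _; rewrite -big_split big1 // => s _ /=.
  by rewrite -mulmxDl -mulmxDr addrA subrK subrr mulmx0 mul0mx.
apply: unitmx_qform => v v0; rewrite qformD gt_eqF //.
apply: ltr_wpDl; last exact: sum_qform_gt0.
exact: qform_gram_ge0.
Qed.

(** With [a = X_k p_s] and [b] the value of [q] at [wpred w], the hypotheses read [a v = g b v] and
    [b v = g^* a v]; hence [(1 - |g|^2) a v = 0], and [|g| < 1]. *)
Lemma recurrence_inverse k s v : let w := k :: s in
  p w *m v = 0 -> q w *m v = 0 -> X k *m p s *m v = 0 /\ q (wpred w) *m v = 0.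
Proof.
move=> w; have [c0 cE] := rhoE w; rewrite (qS k s) (pS k s) -/w.
set a := X k *m p s; set b := q (wpred w).
have cn0 : rho w != 0 by rewrite gt_eqF.
rewrite -!scalemxAl !mulmxBl -!scalemxAl => /eqP; rewrite scaler_eq0 (negbTE cn0) /=.
rewrite subr_eq0 => /eqP av /eqP; rewrite scaler_eq0 (negbTE cn0) /=.
rewrite subr_eq0 => /eqP bv.
have a0 : a *m v = 0.
  apply/eqP; have : (1 - g w * (g w)^*) *: (a *m v) == 0.
    by rewrite scalerBl scale1r subr_eq0 -scalerA -bv -av.
  rewrite scaler_eq0 => /orP[/eqP h|//].
  by move: cE; rewrite h mulr0 => /eqP; rewrite eq_sym oner_eq0.
by rewrite bv a0 scaler0.
Qed.

(** Walks back along predecessors from [w] to [last_word d n]; inverting the recurrence at each word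
    gives [X_k p_s v = 0] there and [q v = 0] at its predecessor. *)
Lemma recurrence_descent n w v : (w == last_word d n) || shortlex (last_word d n) w ->
    q w *m v = 0 ->
    (forall t, (n < size t)%N -> (t == w) || shortlex t w -> p t *m v = 0) ->
  q (last_word d n) *m v = 0 /\
  forall k s, (n < size (k :: s))%N -> (k :: s == w) || shortlex (k :: s) w ->
    X k *m p s *m v = 0.
Proof.
elim/wpred_ind: w => [|k s].
  by case: n => // _ q00 _; split=> // j u; rewrite /shortlex.
set w := k :: s => IHw; case: eqP => [wl _ qw pv|_ /= lw].
  have wn : size w = n by rewrite wl size_nseq.
  rewrite -wl; split=> // j u; rewrite -wn => nu /orP[/eqP h|/shortlex_size].
    by rewrite h ltnn in nu.
  by rewrite leqNgt nu.
move=> qw pv; have w0 : w != [::] by [].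
have nw : (n < size w)%N.
  have := shortlex_size lw; rewrite size_nseq leq_eqVlt => /orP[/eqP|//].
  move=> /esym/last_word_max /orP[/eqP h|h]; first by rewrite h shortlex_irr in lw.
  by have := shortlex_trans h lw; rewrite shortlex_irr.
have [av bv] := recurrence_inverse (pv w nw (introT orP (or_introl (eqxx w)))) qw.
have lw' : (wpred w == last_word d n) || shortlex (last_word d n) (wpred w).
  by rewrite eq_sym -shortlex_wpred.
have [|ql Xl] := IHw lw' bv.
  by move=> t nt tw; apply: pv => //; rewrite (shortlex_wpred t w0) tw orbT.
split=> // j u nu /orP[/eqP[-> ->] //|]; rewrite (shortlex_wpred _ w0).
exact: Xl.
Qed.

(** The descent from length [n.+1] to [n] gives [X_k p_s v = 0] for all [k], and [G = 1] writes
    [p_s v] as the sum of the [X_k^* X_k p_s v]. At [n = 0], [p [::] = 1] concludes. *)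
Lemma sphere_injective n v : G = 1%:M -> q (last_word d n) *m v = 0 ->
  (forall w, size w = n -> p w *m v = 0) -> v = 0.
Proof.
move=> G1; elim: n => [|n IHn] qv pv; first by rewrite -[v]mul1mx -p0 pv.
have lw : (last_word d n.+1 == last_word d n) ||
    shortlex (last_word d n) (last_word d n.+1).
  by rewrite /shortlex !size_nseq ltnSn orbT.
have [|ql Xl] := recurrence_descent lw qv.
  move=> t nt tw; apply: pv; apply/eqP; rewrite eqn_leq nt andbT.
  by case/orP: tw => [/eqP->|/shortlex_size]; rewrite size_nseq.
apply: IHn => // s sn; rewrite -[p s]mul1mx -G1 /G !mulmx_suml big1 // => k _.
have Xs : X k *m p s *m v = 0.
  by apply: Xl; [rewrite /= sn | apply: last_word_max; rewrite /= sn].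
by rewrite -!mulmxA [X k *m _]mulmxA Xs mulmx0.
Qed.

Lemma sphere_unitmx n : G = 1%:M -> A n = B n /\ A n \in unitmx.
Proof.
move=> G1; have AB : A n = B n.
  rewrite gram_telescope G1 subrr [X in _ + X]big1 ?addr0 // => i _.
  by rewrite big1 // => s _; rewrite mulmx0 mul0mx.
split=> //; apply: unitmx_qform => v; apply: contraNneq => Av.
(* The form of [B n] at [v] is a sum of nonnegative terms equal to 0, so each [p w] with [|w| = n]
   annihilates [v]. *)
have Bv := Av; rewrite AB qform_sum in Bv.
apply/eqP/(@sphere_injective n) => //.
  by apply: qform1_eq0; rewrite -qform_gram.
move=> w wn; apply: qform1_eq0; rewrite -qform_gram; apply/eqP.
move/eqP: Bv; rewrite psumr_eq0 => [/allP/(_ w)|u _]; last exact: qform_gram_ge0.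
by rewrite mem_words wn eqxx; exact.
Qed.

End RecurrenceEvaluation.

(** * Evaluation of noncommutative polynomials *)

Section Evaluation.
Context (R : realType) (d m : nat) (Z : 'I_d.+1 -> 'M[R[i]]_m.+1).
Implicit Types (P Q : ncpoly R d).

Lemma ncevalE P : nceval Z P = \sum_(w <- msupp P) mcoeff w P *: \prod_(k <- (w : word d)) Z k.
Proof. by apply: eq_bigr => w _; exact: mul_scalar_mx. Qed.

Lemma nceval_linear (a : R[i]) P Q :
  nceval Z (a *: P + Q) = a *: nceval Z P + nceval Z Q.
Proof.
rewrite !ncevalE.
exact: (msupp_sum_linear (fun w : word d => \prod_(k <- w) Z k)).
Qed.

Lemma nceval_monom w : nceval Z (ncmonom R w) = \prod_(k <- w) Z k.
Proof.
rewrite ncevalE; exact: (msupp_sum_monom (fun w : word d => \prod_(k <- w) Z k)).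
Qed.

Lemma nceval0 : nceval Z 0 = 0.
Proof. by rewrite ncevalE msupp0 big_seq_fset0. Qed.

Lemma nceval1 : nceval Z 1 = 1%:M.
Proof. by rewrite -ncmonom0 nceval_monom big_nil. Qed.

Lemma ncevalZ (a : R[i]) P : nceval Z (a *: P) = a *: nceval Z P.
Proof. by rewrite -[a *: P]addr0 nceval_linear nceval0 addr0. Qed.

Lemma nceval_subZ (a : R[i]) P Q : nceval Z (P - a *: Q) = nceval Z P - a *: nceval Z Q.
Proof.
rewrite [RHS]subZ_swap -nceval_linear.
by congr nceval; exact: subZ_swap.
Qed.

Lemma nceval_ncvar k P : nceval Z (ncvar R k * P) = Z k *m nceval Z P.
Proof.
elim/ncpoly_ind: P => [|a w P IHP]; first by rewrite mulr0 nceval0 mulmx0.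
rewrite mulrDr ncvar_scaleAr ncvarM !nceval_linear IHP !nceval_monom big_cons.
by rewrite mulmxDr -scalemxAr.
Qed.

End Evaluation.

Theorem theorem7p11 (R : realType) (d : nat) (mu : operator R d -> R[i])
    (mu_measure : nc_measure mu) (mu_probability : probability_measure mu)
    (mu_nontrivial : nontrivial mu)
    (n m : nat) (Z : 'I_d.+1 -> 'M[R[i]]_m.+1) :
  let phi (s : word d) := nceval (adj_tuple Z) (orthopoly mu s) in
  let phis (s : word d) := nceval (adj_tuple Z) (reverse_poly mu s) in
  let A := (phis (last_word d n))^t* *m phis (last_word d n) in
  let B := \sum_(s : n.-tuple 'I_d.+1) (phi s)^t* *m phi s in
  [/\ row_ball Z -> A \in unitmx,
      row_ball_ext Z -> B \in unitmx
    & row_sphere Z -> [/\ A \in unitmx, B \in unitmx & A = B]].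
Proof.
move=> phi phis A B; pose X := adj_tuple Z.
have p0 : phi [::] = 1%:M.
  by rewrite /phi (orthopoly_nil mu_measure mu_probability mu_nontrivial) nceval1.
have q0 : phis [::] = 1%:M by rewrite /phis reverse_poly_nil nceval1.
have g1 w : `|verblunsky mu w| < 1.
  case: w => [|k s]; first by rewrite normr0 ltr01.
  by have [] := orthopoly_cons mu_measure mu_probability mu_nontrivial k s.
have pS k s : let w := k :: s in phi w = (sqrtC (1 - `|verblunsky mu w| ^+ 2))^-1 *:
    (X k *m phi s - verblunsky mu w *: phis (wpred w)).
  move=> w; rewrite /phi.
  have [_ ->] := orthopoly_cons mu_measure mu_probability mu_nontrivial k s.
  by rewrite ncevalZ nceval_subZ nceval_ncvar.
have qS k s : let w := k :: s in phis w = (sqrtC (1 - `|verblunsky mu w| ^+ 2))^-1 *: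
    (phis (wpred w) - (verblunsky mu w)^* *: (X k *m phi s)).
  move=> w; rewrite /phis reverse_poly_cons ncevalZ nceval_linear nceval_ncvar.
  by rewrite -subZ_swap.
have GE : \sum_k (X k)^t* *m X k = row_gram Z.
  by apply: eq_bigr => k _; rewrite /X /adj_tuple adjmxK.
(* The sum over tuples of length [n] is turned into one over [words d n], the form used with the
   recurrences. *)
rewrite /B (sum_tuple_words (fun s => (phi s)^t* *m phi s)).
split=> [[_ pos]|[_ pos]|sph].
- by apply: (reverse_unitmx p0 q0 g1 pS qS); rewrite GE.
- by apply: (direct_unitmx p0 q0 g1 pS qS); rewrite GE.
have [AB Au] := sphere_unitmx p0 q0 g1 pS qS n (etrans GE sph).
by split=> //; rewrite -AB.
Qed.
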